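(* Every Coxeter group is biautomatic.
   Context: A Coxeter group $W$ is a group generated by a finite set $S$ subject only to the relations $s^2=1$ for $s\in S$ and $(st)^{m_{st}}=1$ for $s\neq t\in S$, where $m_{st}=m_{ts}\in\{2,3,\ldots,\infty\}$, with the convention that $m_{st}=\infty$ means that no relation between $s$ and $t$ is imposed. Let $G$ be a group with a finite symmetric generating set $S$. For $g\in G$, $\ell(g)$ denotes the word length of $g$, i.e. the minimal $n$ such that $g=s_1\cdots s_n$ with $s_i\in S$. $S^*$ is the set of all words over $S$. If $v\in S^*$ is a word of length $n$, then $v(i)$ denotes the prefix of $v$ of length $i$ for $i=1,\ldots,n-1$, and $v(i)=v$ for $i\geq n$. For a word $v\in S^*$ (or a product of words and formal inverses of words), $\ell(v)$ denotes the word length of the group element it represents. The group $G$ is biautomatic if, for some such $S$, there exist a regular language $\mathcal L\subseteq S^*$ (i.e. the set of words accepted by a finite state automaton over $S$) and constants $C,C'$ such that: (i) for each $g\in G$, there is a word in $\mathcal L$ representing $g$; (ii) for each $s\in S$ and $g,g'\in G$ with $g'=gs$, and each $v,v'\in\mathcal L$ representing $g,g'$ respectively, for all $i\geq 1$ we have $\ell\big(v(i)^{-1}v'(i)\big)\leq C$; (iii) for each $s\in S$ and $g,g'\in G$ with $g'=sg$, and each $v,v'\in\mathcal L$ representing $g,g'$ respectively, for all $i\geq 1$ we have $\ell\big(v(i)^{-1}s^{-1}v'(i)\big)\leq C'$. *)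

(* Defs.v *)
(* Groups, possibly infinite, are the [groupType] of boot/monoid;
   finite subsets of a group are finmap's [{fset G}]. *)
From HB Require Import structures.
From mathcomp Require Import all_boot finmap.

Set Implicit Arguments.
Unset Strict Implicit.
Unset Printing Implicit Defensive.

Local Open Scope group_scope.

(** * Group presentations *)

(* A group word over [I]: [(i, false)] stands for the generator [i] and
   [(i, true)] for its formal inverse. *)
Definition gword (I : Type) := seq (I * bool).

Definition gword_eval (I : Type) (G : groupType) (f : I -> G) (w : gword I) : G :=
  \prod_(x <- w) (if x.2 then (f x.1)^-1 else f x.1).

(* The congruence on group words whose quotient is the group < I | R >. *)
Inductive gword_eq (I : Type) (R : gword I -> Prop) : gword I -> gword I -> Prop :=
| gword_eq_refl w : gword_eq R w w
| gword_eq_sym w w' : gword_eq R w w' -> gword_eq R w' w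
| gword_eq_trans w w' w'' :
    gword_eq R w w' -> gword_eq R w' w'' -> gword_eq R w w''
| gword_eq_cancel u i b v :
    gword_eq R (u ++ [:: (i, b); (i, ~~ b)] ++ v) (u ++ v)
| gword_eq_relator u r v : R r -> gword_eq R (u ++ r ++ v) (u ++ v).

(* [f] induces an isomorphism from < I | R > onto [G]: the [f i] generate [G]
   (surjectivity), and two words agree in [G] exactly when the relations force
   them to (well-definedness and injectivity). *)
Definition presents (I : Type) (R : gword I -> Prop) (G : groupType) (f : I -> G) : Prop :=
  (forall g : G, exists w : gword I, gword_eval f w = g) /\
  (forall w w' : gword I, gword_eval f w = gword_eval f w' <-> gword_eq R w w').

(** * Coxeter groups *)

(* [None] encodes infinity.  The diagonal is unconstrained and is not used in
   [coxeter_relator]. *)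
Record coxeter_matrix (I : finType) := CoxeterMatrix {
  cox_entry :> I -> I -> option nat;
  cox_sym : forall s t, cox_entry s t = cox_entry t s;
  cox_ge2 : forall s t k, s != t -> cox_entry s t = Some k -> 2 <= k
}.

Inductive coxeter_relator (I : finType) (m : coxeter_matrix I) : gword I -> Prop :=
| cox_square s : coxeter_relator m [:: (s, false); (s, false)]
| cox_braid s t k : s != t -> m s t = Some k ->
    coxeter_relator m (flatten (nseq k [:: (s, false); (t, false)])).

Definition coxeter_group (W : groupType) : Prop :=
  exists (I : finType) (m : coxeter_matrix I) (f : I -> W),
    presents (coxeter_relator m) f.

(** * Regular languages *)

Record dfa (A : finType) := Dfa {
  dfa_state : finType;
  dfa_init : dfa_state;
  dfa_step : dfa_state -> A -> dfa_state;
  dfa_final : {set dfa_state}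
}.

Definition dfa_accept (A : finType) (M : dfa A) (w : seq A) : bool :=
  foldl (@dfa_step A M) (dfa_init M) w \in dfa_final M.

Definition regular (A : finType) (L : seq A -> Prop) : Prop :=
  exists M : dfa A, forall w : seq A, L w <-> dfa_accept M w.

(** * Word length and biautomaticity *)

(* The element represented by a word over the subset [S]. *)
Definition word_val (G : groupType) (S : {fset G}) (w : seq S) : G :=
  \prod_(s <- w) val s.

Definition symmetric_set (G : groupType) (S : {fset G}) : Prop :=
  forall s : G, s \in S -> s^-1 \in S.

(* Positive words suffice, as this is only used for symmetric [S]. *)
Definition generating (G : groupType) (S : {fset G}) : Prop :=
  forall g : G, exists w : seq S, word_val w = g.

Lemma generating_size (G : groupType) (S : {fset G}) (genS : generating S) (g : G) :
  exists n, [exists w : n.-tuple S, word_val w == g].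
Proof.
have [w wg] := genS g.
by exists (size w); apply/existsP; exists (in_tuple w); apply/eqP.
Qed.

Definition word_length (G : groupType) (S : {fset G}) (genS : generating S) (g : G) : nat :=
  ex_minn (generating_size genS g).

(* The prefix v(i) is [take i v], which is [v] itself once [size v <= i]. *)
Definition biautomatic (G : groupType) : Prop :=
  exists (S : {fset G}) (genS : generating S),
    symmetric_set S /\
    exists (L : seq S -> Prop) (C C' : nat),
      [/\ regular L,
          forall g : G, exists2 v : seq S, L v & word_val v = g,
          forall (s g g' : G) (v v' : seq S),
            s \in S -> g' = g * s ->
            L v -> word_val v = g -> L v' -> word_val v' = g' ->
            forall i : nat, 1 <= i ->
              word_length genS ((word_val (take i v))^-1 * word_val (take i v')) <= C
        & forall (s g g' : G) (v v' : seq S),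
            s \in S -> g' = s * g ->
            L v -> word_val v = g -> L v' -> word_val v' = g' ->
            forall i : nat, 1 <= i ->
              word_length genS
                ((word_val (take i v))^-1 * s^-1 * word_val (take i v')) <= C'].

(* Main.v *)
Require Import Defs.
From HB Require Import structures.
From mathcomp Require Import all_boot all_order all_algebra finmap.
From mathcomp Require Import boolp reals Rstruct trigo.
From mathcomp Require Import ring lra zify.

Set Implicit Arguments.
Unset Strict Implicit.
Unset Printing Implicit Defensive.

Import Order.TTheory GRing.Theory Num.Theory.

(** A wall is a positive root of the Tits representation, and N(g) denotes the
    finite set of walls that separate 1 from g. Two elements x and x' are in the
    same cone class when N(x) and N(x') are disjoint from the same sets N(y),
    that is when x^-1 and x'^-1 have the same cone type. The proof of
    biautomaticity rests on one construction. Every cone class has a least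
    element for the weak order, its [gate], and the gates have bounded length.
    The voracious projection [proj g = g * gate g^-1] moves from g towards 1 by
    a bounded amount, and the language consists of the words that describe a
    geodesic from 1 to g passing through all the iterates of [proj] at g.

    Existence of the gates. Going down from x inside its class is confluent: if
    two descents of x stay in the class, so does the whole rank two residue
    below x ([cone_confluence]). Since classes are moreover convex
    ([cone_eq_geodesic]), the element reached depends only on the class
    ([gate_class]). As a class is determined by the small roots in N(x), and
    there are finitely many small roots ([small_finite], the theorem of Brink
    and Howlett), there are finitely many gates.

    Right multiplication. The class of [f i * x] is determined by that of x when
    the length increases, so [proj] is monotone for the weak order, and [proj g]
    lies below every descent of g. Hence [projn k (g * f i)] is squeezed between
    two consecutive iterates [projn k.+1 g] and [projn k g]
    ([projn_lipschitz]).

    Left multiplication amounts to moving the base point 1 to [f i]. The iterates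
    of the two projections agree until they reach a point x close to the wall of
    [f i]. From then on, every point z between 1 and x stays close to that wall:
    a wall separating z from it must cross a short path at x, and only finitely
    many roots dominate a bounded number of others ([nsmall_finite],
    [near_wall]). Thus z and [f i * z] are close, and the case of right
    multiplication compares the remaining iterates ([projn_left]).

    Regularity. While a word is read it suffices to remember the cone class of
    the inverse of its value and the values of its short suffixes that follow a
    word of the language ([voracious_regular]).

    Finiteness of the small roots. Along a chain of small roots that goes up by
    simple reflections, the values of the Tits form against the simple roots are
    at most -1 or belong to a finite set, because two walls that cross generate a
    finite group, which is conjugate into a finite standard parabolic subgroup
    ([crossing_parabolic]). A long chain repeats its list of values, and the
    difference of the two roots involved is isotropic, so that one of them
    dominates the other ([descent_bounded]). *)

Local Open Scope group_scope.

(** * Length and weak order in a group generated by involutions *)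

Section Length.
Variables (W : groupType) (I : finType) (f : I -> W).

Definition gen_prod (w : seq I) : W := \prod_(i <- w) f i.

(** The default value 0 is taken outside the subgroup generated by [f]. *)
Definition gen_len (g : W) : nat :=
  if pselect (exists n, `[< exists2 w, gen_prod w = g & size w = n >]) is left e
  then ex_minn e else 0.

(** The weak order: u lies on a geodesic from 1 to x. *)
Definition weak_le u x := gen_len x = gen_len u + gen_len (u^-1 * x).

(** No wall is crossed both by a geodesic from 1 to x and by a geodesic from 1
    to y; equivalently, y belongs to the cone type of x^-1. *)
Definition inv_disjoint x y := gen_len (x^-1 * y) = gen_len x + gen_len y.

(** Cone types are compared at the inverses, so that going up by left
    multiplication acts on the classes. *)
Definition same_cone x x' := forall y, inv_disjoint x y <-> inv_disjoint x' y.

Local Notation ev := gen_prod.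
Local Notation len := gen_len.
Local Notation prefix := weak_le.
Local Notation disj := inv_disjoint.
Local Notation cone_eq := same_cone.

Lemma ev_nil : ev [::] = 1.
Proof. by rewrite /gen_prod big_nil. Qed.

Lemma ev_cons i w : ev (i :: w) = f i * ev w.
Proof. by rewrite /gen_prod big_cons. Qed.

Lemma ev_cat u v : ev (u ++ v) = ev u * ev v.
Proof. by rewrite /gen_prod big_cat. Qed.

Lemma ev_rcons w i : ev (rcons w i) = ev w * f i.
Proof. by rewrite -cats1 ev_cat ev_cons ev_nil mulg1. Qed.

Lemma len_le w : len (ev w) <= size w.
Proof.
rewrite /gen_len; case: pselect => [e|//]; case: ex_minnP => n _; apply.
by apply/asboolP; exists w.
Qed.

Hypothesis f2 : forall i, f i * f i = 1.
Hypothesis fgen : forall g : W, exists w, ev w = g.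

Lemma fV i : (f i)^-1 = f i.
Proof. by apply: mulg1_eq. Qed.

Lemma genK i g : f i * (f i * g) = g.
Proof. by rewrite mulgA f2 mul1g. Qed.

Lemma genKr g i : g * f i * f i = g.
Proof. by rewrite -mulgA f2 mulg1. Qed.

Lemma ev_rev w : ev (rev w) = (ev w)^-1.
Proof.
elim: w => [|i w IH]; first by rewrite ev_nil invg1.
by rewrite rev_cons ev_rcons IH ev_cons invgM fV.
Qed.

Lemma len_wit g : exists2 w, ev w = g & size w = len g.
Proof.
rewrite /gen_len; case: pselect => [e|ne].
  by case: ex_minnP => n /asboolP.
by have [w wg] := fgen g; case: ne; exists (size w); apply/asboolP; exists w.
Qed.

Lemma len1 : len 1 = 0.
Proof. by apply/eqP; rewrite -leqn0 -ev_nil len_le. Qed.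

Lemma len_eq0 g : (len g == 0) = (g == 1).
Proof.
apply/eqP/eqP => [g0|->]; last exact: len1.
by have [w wg] := len_wit g; rewrite g0 => /size0nil w0; rewrite -wg w0 ev_nil.
Qed.

Lemma lenM g h : len (g * h) <= len g + len h.
Proof.
have [u <- <-] := len_wit g; have [v <- <-] := len_wit h.
by rewrite -ev_cat -size_cat len_le.
Qed.

Lemma lenV g : len g^-1 = len g.
Proof.
have H h : len h^-1 <= len h.
  by have [u <- <-] := len_wit h; rewrite -ev_rev -size_rev len_le.
by apply/eqP; rewrite eqn_leq H -{1}[g]invgK H.
Qed.

Lemma len_f i : len (f i) <= 1.
Proof. by rewrite -[f i]mulg1 -ev_nil -ev_cons len_le. Qed.

Lemma len_fM i g : len (f i * g) <= (len g).+1.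
Proof. by apply: leq_trans (lenM _ _) _; rewrite -add1n leq_add2r len_f. Qed.

Lemma len_Mf g i : len (g * f i) <= (len g).+1.
Proof. by rewrite -lenV invgM fV -(lenV g) len_fM. Qed.

Lemma len_le_Mf g i : len g <= (len (g * f i)).+1.
Proof. by rewrite -{1}[g](genKr _ i) len_Mf. Qed.

Lemma len_le_fM g i : len g <= (len (f i * g)).+1.
Proof. by rewrite -{1}[g](genK i) len_fM. Qed.

Lemma len_triV g h k : len (g^-1 * h) <= len (g^-1 * k) + len (k^-1 * h).
Proof. by rewrite -{1}[h](mulVKg k) mulgA lenM. Qed.

Lemma len_sym g h : len (g^-1 * h) = len (h^-1 * g).
Proof. by rewrite -lenV invgM invgK. Qed.

Lemma left_descent g : g != 1 -> exists i, (len (f i * g)).+1 = len g.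
Proof.
move=> g1; have [[|i w] wg sw] := len_wit g.
  by rewrite -wg ev_nil eqxx in g1.
exists i; apply/eqP; rewrite eqn_leq len_le_fM andbT -sw -wg ev_cons genK ltnS.
exact: len_le.
Qed.

Lemma right_descent g : g != 1 -> exists i, (len (g * f i)).+1 = len g.
Proof.
move=> g1; have gV1 : g^-1 != 1 by rewrite invg_eq1.
have [i] := left_descent gV1; rewrite lenV => <-; exists i.
by rewrite -[in RHS]lenV invgM invgK fV.
Qed.

Lemma prefix_refl x : prefix x x.
Proof. by rewrite /prefix mulVg len1 addn0. Qed.

Lemma prefix_trans v u x : prefix u v -> prefix v x -> prefix u x.
Proof.
rewrite /prefix => uv vx; have := lenM u (u^-1 * x); rewrite mulVKg.
by have := len_triV u x v; lia.
Qed.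

Lemma prefix_len u x : prefix u x -> len u <= len x.
Proof. by move=> ->; rewrite leq_addr. Qed.

Lemma prefix_antisym u v : prefix u v -> prefix v u -> u = v.
Proof.
rewrite /prefix => uv vu; have : len (u^-1 * v) == 0 by lia.
by rewrite len_eq0 => /eqP/(congr1 (fun g => u * g)); rewrite mulVKg mulg1.
Qed.

Lemma disj_prefix u x y : prefix u x -> disj x y -> disj u y.
Proof.
rewrite /prefix /disj => ux xy; have := len_triV x y u.
have := lenM u^-1 y; rewrite (lenV u) (len_sym x u) xy ux.
by move: (len (u^-1 * y)) (len (u^-1 * x)) (len u) (len y); lia.
Qed.

(** The set of the y disjoint from x decreases when x goes up. *)
Lemma cone_eq_convex u v x :
  prefix u v -> prefix v x -> cone_eq u x -> cone_eq v x.
Proof.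
move=> uv vx ux y; split=> [vy|]; last exact: disj_prefix.
by apply/ux; apply: disj_prefix uv vy.
Qed.

Lemma prefix_Mf x i : (len (x * f i)).+1 = len x -> prefix (x * f i) x.
Proof.
move=> xi; rewrite /prefix invgM fV -mulgA mulVg mulg1.
have := len_f i; have := lenM (x * f i) (f i); rewrite genKr; lia.
Qed.

Lemma prefix_descent u x : prefix u x -> u != x ->
  exists i, (len (x * f i)).+1 = len x /\ prefix u (x * f i).
Proof.
move=> ux u_x; have ux1 : u^-1 * x != 1.
  by apply: contra u_x => /eqP h; rewrite -[x](mulVKg u) h mulg1.
have [i hi] := right_descent ux1; exists i; move: ux; rewrite /prefix mulgA => ux.
have := lenM u (u^-1 * x * f i); rewrite -mulgA mulVKg mulgA.
have := len_le_Mf x i; move: hi.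
by move: (len (u^-1 * x * f i)) (len (u^-1 * x)) (len (x * f i)) ux => *; lia.
Qed.

End Length.

Opaque gen_len.

Local Close Scope group_scope.
Local Open Scope ring_scope.

(** * Chebyshev values *)

Section Chebyshev.
Variable R : realType.

(** At t = 2 cos x this is sin (n x) / sin x: two consecutive values are the
    coordinates of a root of a dihedral group in its two simple roots. *)
Fixpoint cheb (t : R) (n : nat) : R :=
  match n with
  | 0%N => 0
  | 1%N => 1
  | (k.+1 as n').+1 => t * cheb t n' - cheb t k
  end.

Lemma chebSS t n : cheb t n.+2 = t * cheb t n.+1 - cheb t n.
Proof. by []. Qed.

Lemma cheb2 n : cheb 2 n = n%:R.
Proof.
suff [] : cheb 2 n = n%:R /\ cheb 2 n.+1 = n.+1%:R by [].
by elim: n => [|n [IH1 IH2]] //; split=> //; rewrite chebSS IH1 IH2 -!natr1; ring.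
Qed.

Lemma cheb_sin x n : sin x * cheb (2 * cos x) n = sin (n%:R * x).
Proof.
suff [] : sin x * cheb (2 * cos x) n = sin (n%:R * x) /\
  sin x * cheb (2 * cos x) n.+1 = sin (n.+1%:R * x) by [].
elim: n => [|n [IH1 IH2]]; first by rewrite mul0r sin0 mulr0 mul1r mulr1.
split=> //; rewrite chebSS.
transitivity (2 * cos x * (sin x * cheb (2 * cos x) n.+1) - sin x * cheb (2 * cos x) n).
  by ring.
rewrite IH2 IH1.
have -> : n.+2%:R * x = n.+1%:R * x + x by rewrite -(natr1 n.+1); ring.
have -> : n%:R * x = n.+1%:R * x - x by rewrite -(natr1 n); ring.
by rewrite sinB sinD; ring.
Qed.

(** An infinite label gets the limit value 1 of the cosines. *)
Definition cosm (o : option nat) : R :=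
  if o is Some k then cos (pi / k%:R) else 1.

Lemma cosm_bounds o : (forall k, o = Some k -> 2 <= k)%N -> 0 <= cosm o <= 1.
Proof.
case: o => [k|] /= H; last by rewrite ler01 lexx.
have k2 := H _ erefl; rewrite cos_le1 andbT.
have k0 : (0 < k%:R :> R) by rewrite ltr0n; lia.
have k2R : (2 <= k%:R :> R) by rewrite ler_nat.
have p0 := pi_gt0 R.
apply: cos_ge0_pihalf; apply/andP; split.
  by apply: (@le_trans _ _ 0); [lra | rewrite divr_ge0 // ?ltW].
by rewrite ler_pM2l // lef_pV2 // posrE.
Qed.

Section Finite.
Variables (k : nat) (k2 : (2 <= k)%N).
Let x : R := pi / k%:R.

Let cE : cosm (Some k) = cos x. Proof. by []. Qed.
Let kR : (0 < k%:R :> R). Proof. by rewrite ltr0n; lia. Qed.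
Let x_gt0 : 0 < x. Proof. by rewrite divr_gt0 ?pi_gt0. Qed.
Let kx : k%:R * x = pi. Proof. by rewrite /x mulrC divfK // gt_eqF. Qed.

Let sinx_gt0 : 0 < sin x.
Proof.
apply: sin_gt0_pi; rewrite x_gt0 /= -kx -[ltLHS]mul1r ltr_pM2r //.
by rewrite ltr1n.
Qed.

Lemma cosm_lt1 : cosm (Some k) < 1.
Proof.
have := cos2Dsin2 x; rewrite /= -/x => H.
have : 0 < sin x ^+ 2 by rewrite exprn_gt0.
nra.
Qed.

Lemma cheb_ge0 n : (n <= k)%N -> 0 <= cheb (2 * cosm (Some k)) n.
Proof.
move=> nk; rewrite -(pmulr_rge0 _ sinx_gt0) cE cheb_sin.
apply: sin_ge0_pi; rewrite mulr_ge0 ?ler0n ?(ltW x_gt0) //=.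
by rewrite -kx ler_pM2r // ler_nat.
Qed.

Lemma cheb_2k : cheb (2 * cosm (Some k)) (k + k) = 0.
Proof.
apply: (mulfI (lt0r_neq0 sinx_gt0)); rewrite cE cheb_sin natrD mulrDl kx mulr0.
by rewrite -mulr2n sin2pi.
Qed.

Lemma cheb_2kS : cheb (2 * cosm (Some k)) (k + k).+1 = 1.
Proof.
apply: (mulfI (lt0r_neq0 sinx_gt0)); rewrite cE cheb_sin mulr1.
rewrite -natr1 natrD !mulrDl kx mul1r -mulr2n.
by rewrite addrC sinD2pi.
Qed.

Lemma cheb_2kP : cheb (2 * cosm (Some k)) (k + k).-1 = -1.
Proof.
have := chebSS (2 * cosm (Some k)) (k + k).-1.
have -> : (k + k).-1.+2 = (k + k).+1 by lia.
have -> : (k + k).-1.+1 = (k + k)%N by lia.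
rewrite cheb_2kS cheb_2k; lra.
Qed.
End Finite.

End Chebyshev.

(** * The Tits form *)

Section Space.
Variables (R : realType) (I : finType).

Definition vect := {ffun I -> R^o}.
Implicit Types (u v w : vect) (a : R) (i j : I).

Definition co v i : R := v i.
Definition bas i : vect := [ffun j => (i == j)%:R].

Lemma coP u v : (forall i, co u i = co v i) <-> u = v.
Proof. by split=> [H|->//]; apply/ffunP. Qed.
Lemma coD u v i : co (u + v) i = co u i + co v i.
Proof. by rewrite /co ffunE. Qed.
Lemma coN v i : co (- v) i = - co v i.
Proof. by rewrite /co ffunE. Qed.
Lemma coZ a v i : co (a *: v) i = a * co v i.
Proof. by rewrite /co ffunE. Qed.
Lemma co0 i : co 0 i = 0.
Proof. by rewrite /co ffunE. Qed.
Lemma co_bas i j : co (bas i) j = (i == j)%:R.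
Proof. by rewrite /co ffunE. Qed.

Definition coE := (coD, coN, coZ, co0).

Lemma co_sum (F : I -> vect) j : co (\sum_i F i) j = \sum_i co (F i) j.
Proof. by rewrite /co sum_ffunE. Qed.

Lemma bas_sum v : v = \sum_i co v i *: bas i.
Proof.
apply/coP => j; rewrite co_sum (bigD1 j) //= big1 => [|i ij].
  by rewrite addr0 coZ co_bas eqxx mulr1.
by rewrite coZ co_bas (negbTE ij) mulr0.
Qed.

End Space.

Ltac vec := apply/coP => ?; rewrite ?coE.

(** [alt_next n a b] is the letter that continues the word [alt_word n a b]. *)
Fixpoint alt_word (T : Type) (n : nat) (a b : T) : seq T :=
  if n is n'.+1 then a :: alt_word n' b a else [::].

Definition alt_next (T : Type) (n : nat) (a b : T) : T := if odd n then b else a.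

Lemma size_altw (T : Type) n (a b : T) : size (alt_word n a b) = n.
Proof. by elim: n a b => //= n IH a b; rewrite IH. Qed.

Lemma nxtS (T : Type) n (a b : T) : alt_next n.+1 a b = alt_next n b a.
Proof. by rewrite /alt_next /=; case: odd. Qed.

Lemma altw_cat (T : Type) n k (a b : T) :
  alt_word (n + k) a b = alt_word n a b ++ alt_word k (alt_next n a b) (alt_next n b a).
Proof. by elim: n a b => //= n IH a b; rewrite IH !nxtS. Qed.

Lemma altw_rcons (T : Type) n (a b : T) :
  alt_word n.+1 a b = rcons (alt_word n a b) (alt_next n a b).
Proof. by rewrite -addn1 altw_cat cats1. Qed.

Lemma rev_altw (T : Type) n (a b : T) :
  rev (alt_word n a b) = alt_word n (alt_next n b a) (alt_next n a b).
Proof. by elim: n => // n IH; rewrite altw_rcons rev_rcons IH !nxtS. Qed.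

Section Form.
Variables (R : realType) (I : finType) (m : coxeter_matrix I).
Local Notation V := (vect R I).
Implicit Types (u v w : V) (a : R) (i j : I).

Definition cartan i j : R := if i == j then 1 else - cosm R (m i j).

Lemma cartan_sym i j : cartan i j = cartan j i.
Proof. by rewrite /cartan eq_sym cox_sym. Qed.

Lemma cartan_le0 i j : i != j -> cartan i j <= 0.
Proof.
move=> ij; rewrite /cartan (negbTE ij) oppr_le0.
by have /andP[] := @cosm_bounds R (m i j) (fun k => @cox_ge2 _ m i j k ij).
Qed.

Definition form u v : R := \sum_i \sum_j co u i * co v j * cartan i j.

Lemma formC u v : form u v = form v u.
Proof.
rewrite /form exchange_big /=; apply: eq_bigr => i _; apply: eq_bigr => j _.
by rewrite cartan_sym; ring.
Qed.

Lemma formDl u v w : form (u + v) w = form u w + form v w.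
Proof.
rewrite /form -big_split; apply: eq_bigr => i _ /=; rewrite -big_split.
by apply: eq_bigr => j _ /=; rewrite coE; ring.
Qed.

Lemma formZl a u v : form (a *: u) v = a * form u v.
Proof.
rewrite /form mulr_sumr; apply: eq_bigr => i _ /=; rewrite mulr_sumr.
by apply: eq_bigr => j _ /=; rewrite coE; ring.
Qed.

Lemma formNl u v : form (- u) v = - form u v.
Proof. by rewrite -scaleN1r formZl mulN1r. Qed.
Lemma formDr u v w : form u (v + w) = form u v + form u w.
Proof. by rewrite formC formDl !(formC u). Qed.
Lemma formZr a u v : form u (a *: v) = a * form u v.
Proof. by rewrite formC formZl (formC u). Qed.
Lemma formNr u v : form u (- v) = - form u v.
Proof. by rewrite formC formNl (formC u). Qed.
Definition formE := (formDl, formDr, formZl, formZr, formNl, formNr).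

Lemma form_bas i j : form (bas R i) (bas R j) = cartan i j.
Proof.
rewrite /form (bigD1 i) //= (bigD1 j) //= !big1; last first.
- by move=> k kj; rewrite !co_bas (eq_sym j) (negbTE kj) !(mulr0, mul0r).
- move=> k ki; rewrite big1 // => l _.
  by rewrite co_bas (eq_sym i) (negbTE ki) !(mulr0, mul0r).
by rewrite !co_bas !eqxx !addr0 !mul1r.
Qed.

Lemma form_suml u v : form u v = \sum_i co u i * form (bas R i) v.
Proof.
rewrite {1}(bas_sum u); elim/big_rec2: _ => [|i y1 y2 _ <-].
  by rewrite -[0](scale0r 0) formZl mul0r.
by rewrite formDl formZl.
Qed.

Definition refl (b v : V) : V := v - (2 * form v b) *: b.

Lemma reflD b u v : refl b (u + v) = refl b u + refl b v.
Proof. by rewrite /refl formDl; vec; ring. Qed.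
Lemma reflZ b a v : refl b (a *: v) = a *: refl b v.
Proof. by rewrite /refl formZl; vec; ring. Qed.

Lemma reflK b : form b b = 1 -> involutive (refl b).
Proof. by move=> bb v; rewrite /refl !formE bb; vec; ring. Qed.

Lemma form_refl b u v : form b b = 1 -> form (refl b u) (refl b v) = form u v.
Proof. by move=> bb; rewrite /refl !formE bb (formC b); ring. Qed.

Lemma refl_self b : form b b = 1 -> refl b b = - b.
Proof. by move=> bb; rewrite /refl bb; vec; ring. Qed.

Lemma form_ii i : form (bas R i) (bas R i) = 1.
Proof. by rewrite form_bas /cartan eqxx. Qed.

Definition simple_refl i := refl (bas R i).

Definition actw (w : seq I) (v : V) : V := foldr simple_refl v w.

Lemma actw_cat (s1 s2 : seq I) v : actw (s1 ++ s2) v = actw s1 (actw s2 v).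
Proof. by rewrite /actw foldr_cat. Qed.
Lemma actwD (s : seq I) u v : actw s (u + v) = actw s u + actw s v.
Proof. by elim: s => //= i s ->; rewrite /simple_refl reflD. Qed.
Lemma actwZ (s : seq I) a v : actw s (a *: v) = a *: actw s v.
Proof. by elim: s => //= i s ->; rewrite /simple_refl reflZ. Qed.
Lemma form_actw (s : seq I) u v : form (actw s u) (actw s v) = form u v.
Proof. by elim: s => //= i s <-; rewrite /simple_refl form_refl // form_ii. Qed.

(** The displacement of v lies in the plane of b and c, and it is orthogonal to
    it because g preserves the form and fixes b and c. The form is definite on
    that plane since its value at (b, c) is strictly between -1 and 1. *)
Lemma isometry_plane (g : V -> V) (b c v : V) (x y : R) :
  form b b = 1 -> form c c = 1 -> -1 < form b c < 1 ->
  g b = b -> g c = c -> (forall u w, form (g u) (g w) = form u w) ->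
  g v = v + x *: b + y *: c -> g v = v.
Proof.
move=> bb cc /andP[lo hi] gb gc iso gv.
have eb : x + y * form b c = 0.
  by have := iso v b; rewrite gb gv !formE bb (formC c b); lra.
have ec : x * form b c + y = 0.
  by have := iso v c; rewrite gc gv !formE cc; lra.
have D : form b c ^+ 2 < 1 by nra.
have y0 : y = 0.
  have : y * (1 - form b c ^+ 2) = 0.
    have -> : y * (1 - form b c ^+ 2) =
      (x * form b c + y) - form b c * (x + y * form b c) by ring.
    by rewrite eb ec; ring.
  by move=> /eqP; rewrite mulf_eq0 => /orP[/eqP//|/eqP]; lra.
have x0 : x = 0 by rewrite y0 in eb; lra.
by rewrite gv x0 y0 !scale0r !addr0.
Qed.

Lemma sg_plane n i j v :
  exists x y, actw (alt_word n i j) v = v + x *: bas R i + y *: bas R j.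
Proof.
elim: n i j => [|n IH] i j /=; first by exists 0, 0; rewrite !scale0r !addr0.
have [x [y ->]] := IH j i.
exists (y - 2 * form (v + x *: bas R j + y *: bas R i) (bas R i)), x.
by rewrite /simple_refl /refl; vec; ring.
Qed.

Lemma altw_act n i j : i != j ->
  actw (alt_word n i j) (bas R (alt_next n i j)) =
  cheb (2 * cosm R (m i j)) n.+1 *: bas R i + cheb (2 * cosm R (m i j)) n *: bas R j.
Proof.
elim: n i j => [|n IH] i j ij.
  by rewrite /= scale1r scale0r addr0.
rewrite nxtS [alt_word _ _ _]/= [actw _ _]/= IH 1?eq_sym // chebSS /simple_refl /refl !formE.
rewrite form_ii form_bas /cartan (eq_sym j) (negbTE ij) (cox_sym m j i).
by vec; ring.
Qed.

(** The word of length 2k brings both simple roots back to themselves, so it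
    fixes their plane pointwise. *)
Lemma braid_act i j k v : i != j -> m i j = Some k ->
  actw (alt_word (k + k) i j) v = v.
Proof.
move=> ij mk; have k2 := cox_ge2 ij mk.
have [x [y E]] := sg_plane (k + k) i j v.
have ei : actw (alt_word (k + k) i j) (bas R i) = bas R i.
  have := altw_act (k + k) ij; rewrite /alt_next oddD addbb mk.
  by rewrite cheb_2kS // cheb_2k // scale1r scale0r addr0.
have ej : actw (alt_word (k + k) i j) (bas R j) = bas R j.
  have := altw_act (k + k).-1 ij.
  have := @altw_rcons I (k + k).-1 i j.
  have -> : (k + k).-1.+1 = (k + k)%N by lia.
  have -> : alt_next (k + k).-1 i j = j.
    by rewrite /alt_next; have -> : odd (k + k).-1 by lia.
  move=> -> H; rewrite -cats1 actw_cat /= /simple_refl refl_self ?form_ii //.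
  rewrite -scaleN1r actwZ H mk.
  by rewrite cheb_2k // cheb_2kP //; vec; ring.
apply: (@isometry_plane _ _ _ _ x y (form_ii i) (form_ii j) _ ei ej (form_actw _) E).
rewrite form_bas /cartan (negbTE ij) mk.
have := cosm_lt1 R k2.
have /andP[] : 0 <= cosm R (Some k) <= 1 by apply: cosm_bounds => l [<-].
by move=> h1 h2 h3; lra.
Qed.

End Form.

(** * The Tits representation *)

Section Coxeter.
Variables (R : realType) (W : groupType) (I : finType).
Variables (m : coxeter_matrix I) (f : I -> W).
Hypothesis pres : presents (coxeter_relator m) f.

Local Notation V := (vect R I).
Local Notation alpha := (bas R).
Local Notation B := (form m).
Local Notation ev := (gen_prod f).
Local Notation len := (gen_len f).
Local Notation prefix := (weak_le f).
Local Notation disj := (inv_disjoint f).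
Local Notation cone_eq := (same_cone f).
Implicit Types (g h : W) (b c : V) (i j : I).

Lemma pres_f2 i : (f i * f i = 1)%g.
Proof.
have /pres.2 : gword_eq (coxeter_relator m) [:: (i, false); (i, false)] [::].
  by have := gword_eq_relator [::] [::] (cox_square m i).
by rewrite /gword_eval !big_cons !big_nil mulg1.
Qed.
Local Notation f2 := pres_f2.

Lemma gword_ev (w : gword I) : gword_eval f w = ev (map fst w).
Proof.
rewrite /gword_eval /gen_prod big_map; apply: eq_bigr => -[i []] _ //=.
exact: fV f2 i.
Qed.

Lemma pres_gen g : exists w, ev w = g.
Proof. by have [w <-] := pres.1 g; exists (map fst w); rewrite gword_ev. Qed.
Local Notation fgen := pres_gen.

Lemma cox_genKr g i : (g * f i * f i = g)%g.
Proof. exact: genKr f2 g i. Qed.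

Lemma cox_genK i g : (f i * (f i * g) = g)%g.
Proof. exact: genK f2 i g. Qed.

Lemma altw_gword k i j :
  map fst (flatten (nseq k [:: (i, false); (j, false)])) = alt_word (k + k) i j.
Proof. by elim: k => // k IH; rewrite addnS addSn /= IH. Qed.

(** Reflections satisfy the Coxeter relations, hence the action of words
    descends to the group. *)
Lemma gword_eq_act (w w' : gword I) v : gword_eq (coxeter_relator m) w w' ->
  actw m (map fst w) v = actw m (map fst w') v :> V.
Proof.
move=> H; elim: H v => {w w'} //.
- by move=> w w' w'' _ IH1 _ IH2 v; rewrite IH1.
- move=> u i b u' v; rewrite !map_cat !actw_cat /= /simple_refl reflK //.
  exact: form_ii.
- move=> u r u' Rr v; rewrite !map_cat !actw_cat; congr (actw _ _ _).
  case: Rr => [i|i j k ij mk] /=; first by rewrite /simple_refl reflK // form_ii.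
  by rewrite altw_gword (braid_act _ ij mk).
Qed.

Lemma ev_act (w w' : seq I) v : ev w = ev w' -> actw m w v = actw m w' v :> V.
Proof.
move=> ww'; have fstK u : map fst (map (fun i : I => (i, false)) u) = u.
  by rewrite -map_comp map_id_in.
rewrite -(fstK w) -(fstK w'); apply: gword_eq_act; apply/pres.2.
by rewrite !gword_ev !fstK.
Qed.

Lemma ev_braid i j k : i != j -> m i j = Some k ->
  ev (alt_word k i j) = ev (alt_word k j i).
Proof.
move=> ij mk; have : ev (alt_word (k + k) i j) = 1%g.
  rewrite -altw_gword -gword_ev.
  have /pres.2 -> : gword_eq (coxeter_relator m)
      (flatten (nseq k [:: (i, false); (j, false)])) [::].
    by have := gword_eq_relator [::] [::] (cox_braid ij mk); rewrite /= cats0.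
  by rewrite /gword_eval big_nil.
rewrite altw_cat -[alt_word k (alt_next _ _ _) _]rev_altw ev_cat ev_rev; last exact: f2.
by move/divg1_eq.
Qed.

(** By [ev_act] the choice of a word for g does not matter. *)
Definition act (g : W) (v : V) : V :=
  if pselect (exists w, ev w = g) is left e then actw m (sval (cid e)) v else v.

Lemma act_ev w v : act (ev w) v = actw m w v.
Proof.
rewrite /act; case: pselect => [e|ne]; last by case: ne; exists w.
by apply: ev_act; case: cid.
Qed.

Lemma actM g h v : act (g * h) v = act g (act h v).
Proof.
by have [[u <-] [w <-]] := (fgen g, fgen h); rewrite -ev_cat !act_ev actw_cat.
Qed.

Lemma act1 v : act 1 v = v.
Proof. by rewrite -(ev_nil f) act_ev. Qed.

Lemma act_f i v : act (f i) v = simple_refl m i v.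
Proof. by rewrite -[f i]mulg1 -(ev_nil f) -ev_cons act_ev. Qed.

Lemma actK g v : act g^-1 (act g v) = v.
Proof. by rewrite -actM mulVg act1. Qed.

Lemma actVK g v : act g (act g^-1 v) = v.
Proof. by rewrite -actM mulgV act1. Qed.

Lemma actD g u v : act g (u + v) = act g u + act g v.
Proof. by have [w <-] := fgen g; rewrite !act_ev actwD. Qed.

Lemma actZ g a v : act g (a *: v) = a *: act g v.
Proof. by have [w <-] := fgen g; rewrite !act_ev actwZ. Qed.

Lemma actN g v : act g (- v) = - act g v.
Proof. by rewrite -scaleN1r actZ scaleN1r. Qed.

Lemma form_act g u v : B (act g u) (act g v) = B u v.
Proof. by have [w <-] := fgen g; rewrite !act_ev form_actw. Qed.

Lemma act_sum g v : act g v = \sum_i co v i *: act g (alpha i).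
Proof.
rewrite {1}(bas_sum v); elim/big_rec2: _ => [|i y1 y2 _ <-].
  by rewrite -[0](scale0r 0) actZ !scale0r.
by rewrite actD actZ.
Qed.

Opaque act.

(** * Positive and negative roots *)

(** Tits's theorem. Write g as v times an alternating word in two letters that
    would be continued by i, with lengths adding up and the word as long as
    possible. By maximality v goes up along both letters, so by induction it maps
    their simple roots to nonnegative vectors. The alternating word is shorter
    than the braid relation, for otherwise it could be rewritten to end with i;
    hence it maps [alpha i] to a combination of the two simple roots with
    nonnegative Chebyshev coefficients. *)
Lemma act_simple_ge0 g i : (len g <= len (g * f i))%N ->
  forall j, 0 <= co (act g (alpha i)) j.
Proof.
have [n] := ubnP (len g); elim: n g i => // n IH g i lgn gi.
have [->|g1] := eqVneq g 1%g.
  by move=> l; rewrite act1 co_bas ler0n.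
have [j gj] := right_descent f2 fgen g1.
pose P k := `[< exists (v : W) (a b : I), [/\ a != b, g = (v * ev (alt_word k a b))%g,
  len g = (len v + k)%N & alt_next k a b = i] >].
have P1 : P 1%N.
  apply/asboolP; exists (g * f j)%g, j, i; split=> //.
  - by apply: contraTneq gi => <-; rewrite -gj ltnn.
  - by rewrite /= ev_cons ev_nil mulg1 cox_genKr.
  - by rewrite addn1.
have Pex : exists k, P k by exists 1%N.
have Pub k : P k -> (k <= len g)%N.
  by move=> /asboolP[v [a [b [_ _ -> _]]]]; rewrite leq_addl.
case: (ex_maxnP Pex Pub) => k /asboolP[v [a [b [ab gE gl ki]]]] kmax.
have k0 : (0 < k)%N by apply: kmax.
have vb : (len v <= len (v * f b))%N.
  rewrite leqNgt; apply/negP => vb.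
  have : P k.+1.
    apply/asboolP; exists (v * f b)%g, b, a; split.
    - by rewrite eq_sym.
    - by rewrite [alt_word _ _ _]/= ev_cons mulgA cox_genKr.
    - have := len_le_Mf f2 fgen v b; lia.
    - by rewrite nxtS.
  by move/kmax; rewrite ltnn.
have va : (len v <= len (v * f a))%N.
  rewrite leqNgt; apply/negP => va.
  have gE' : g = (v * f a * ev (alt_word k.-1 b a))%g.
    by rewrite gE -{1}(prednK k0) [alt_word _ _ _]/= ev_cons mulgA.
  have := lenM fgen (v * f a)%g (ev (alt_word k.-1 b a)).
  have := len_le f (alt_word k.-1 b a); rewrite size_altw -gE'; lia.
have km q : m a b = Some q -> (k < q)%N.
  move=> mq; rewrite ltnNge; apply/negP => qk.
  have q2 := cox_ge2 ab mq.
  pose x := alt_next (k - q) a b; pose y := alt_next (k - q) b a.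
  have xy : x != y by rewrite /x /y /alt_next; case: odd; rewrite // eq_sym.
  have mxy : m x y = Some q.
    by rewrite /x /y /alt_next; case: odd; rewrite // cox_sym.
  have kE : k = (k - q + q)%N by rewrite subnK.
  have lasti : alt_next q.-1 y x = i.
    rewrite -ki kE /x /y /alt_next oddD.
    have -> : odd q.-1 = ~~ odd q by lia.
    by case: (odd q); case: (odd (k - q)).
  have gE' : (g * f i)%g = (v * (ev (alt_word (k - q) a b) * ev (alt_word q.-1 y x)))%g.
    rewrite gE {1}kE altw_cat ev_cat -/x -/y (ev_braid xy mxy).
    have -> : alt_word q y x = rcons (alt_word q.-1 y x) i.
      by rewrite -lasti -altw_rcons prednK //; lia.
    by rewrite ev_rcons !mulgA cox_genKr.
  have := lenM fgen v (ev (alt_word (k - q) a b) * ev (alt_word q.-1 y x))%g.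
  rewrite -gE' -ev_cat.
  have := len_le f (alt_word (k - q) a b ++ alt_word q.-1 y x).
  rewrite size_cat !size_altw; lia.
have vn : (len v < n)%N by lia.
have cge0 l : (l <= k.+1)%N -> 0 <= cheb (2 * cosm R (m a b)) l.
  case mab: (m a b) => [q|] lk; last by rewrite mulr1 cheb2 ler0n.
  apply: cheb_ge0; first exact: (cox_ge2 ab mab).
  by have := km _ mab; lia.
move=> l; rewrite gE actM act_ev -ki altw_act // actD !actZ !coE.
by rewrite addr_ge0 // mulr_ge0 ?cge0 ?IH.
Qed.

Definition root b := exists g i, b = act g (alpha i).

(** On roots this singles out the negative ones, as all the coordinates of a root
    have the same sign ([root_cases]). *)
Definition negative b := [exists i, co b i < 0].

Lemma root_act g b : root b -> root (act g b).
Proof. by move=> [h [i ->]]; exists (g * h)%g, i; rewrite actM. Qed.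

Lemma root_simple i : root (alpha i).
Proof. by exists 1%g, i; rewrite act1. Qed.

Lemma act_simple_sg g i : act (g * f i) (alpha i) = - act g (alpha i).
Proof. by rewrite actM act_f /simple_refl refl_self ?form_ii // actN. Qed.

Lemma rootN b : root b -> root (- b).
Proof. by move=> [g [i ->]]; exists (g * f i)%g, i; rewrite act_simple_sg. Qed.

Lemma form_root b : root b -> B b b = 1.
Proof. by move=> [g [i ->]]; rewrite form_act form_ii. Qed.

Lemma root_neq0 b : root b -> b != 0.
Proof.
move=> rb; apply/eqP => b0; have := form_root rb.
by rewrite b0 -[0](scale0r 0) formZl mul0r => /eqP; rewrite eq_sym oner_eq0.
Qed.

Lemma root_cases b : root b ->
  (forall i, 0 <= co b i) \/ (forall i, co b i <= 0).
Proof.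
move=> [g [i ->]]; have [gi|gi] := leqP (len g) (len (g * f i)).
  by left=> j; apply: act_simple_ge0.
right=> j; rewrite -oppr_ge0 -coN -act_simple_sg; apply: act_simple_ge0.
by rewrite cox_genKr ltnW.
Qed.

Lemma vec_neq0 v : v != 0 :> V -> exists i, co v i != 0.
Proof.
move=> v0; apply: contrapT => H; move/eqP: v0; apply; apply/coP => i.
by rewrite co0; apply/eqP; apply: contrapT => /negP h; apply: H; exists i.
Qed.

Lemma ng_le0 b : root b -> negative b -> forall i, co b i <= 0.
Proof.
move=> rb /existsP[j bj]; have [H|//] := root_cases rb.
by have := H j; rewrite leNgt bj.
Qed.

Lemma ngN_ge0 b : ~~ negative b -> forall i, 0 <= co b i.
Proof. by move=> /existsPn H i; rewrite leNgt. Qed.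

Lemma ng_ge0 b : (forall i, 0 <= co b i) -> ~~ negative b.
Proof. by move=> H; apply/existsPn => i; rewrite -leNgt. Qed.

Lemma le0_ng b : root b -> (forall i, co b i <= 0) -> negative b.
Proof.
move=> rb H; have [i bi] := vec_neq0 (root_neq0 rb).
by apply/existsP; exists i; rewrite lt_neqAle bi H.
Qed.

Lemma ng_opp b : root b -> negative (- b) = ~~ negative b.
Proof.
move=> rb; apply/idP/idP => [nb|/ngN_ge0 pb].
  apply: ng_ge0 => i; rewrite -oppr_le0 -coN; apply: ng_le0 nb i; exact: rootN.
by apply: le0_ng (rootN rb) _ => i; rewrite coN oppr_le0.
Qed.

Lemma ng_simple i : negative (alpha i) = false.
Proof. by apply/negbTE/ng_ge0 => j; rewrite co_bas ler0n. Qed.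

Lemma ng_act g i : negative (act g (alpha i)) = (len (g * f i) < len g)%N.
Proof.
have rg : root (act g (alpha i)) by exists g, i.
rewrite ltnNge; apply/idP/idP => [ngi|].
  by apply: contraL ngi => /act_simple_ge0/ng_ge0.
rewrite -ltnNge => gi; rewrite -[act _ _]opprK -act_simple_sg ng_opp.
  by apply/ng_ge0/act_simple_ge0; rewrite cox_genKr ltnW.
by exists (g * f i)%g, i.
Qed.

(** The two elements map [alpha i] to opposite roots. *)
Lemma len_neq g i : len (g * f i) != len g.
Proof.
apply/eqP => E; have rg : root (act g (alpha i)) by exists g, i.
have : ~~ negative (act (g * f i) (alpha i)).
  by rewrite ng_act cox_genKr E ltnn.
by rewrite act_simple_sg ng_opp // ng_act E ltnn.
Qed.

Lemma len_Mf_cases g i :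
  (len (g * f i) = (len g).+1 \/ (len (g * f i)).+1 = len g)%N.
Proof.
have := len_neq g i; have := len_Mf f2 fgen g i; have := len_le_Mf f2 fgen g i.
lia.
Qed.

Lemma ng_comb b c d x y s : root b -> root c -> root d -> 0 <= x -> 0 <= y ->
  d = x *: b + y *: c -> negative b = s -> negative c = s -> negative d = s.
Proof.
move=> rb rc rd x0 y0 dE; case: s => nb nc.
  apply: le0_ng => // i; rewrite dE !coE.
  have := ng_le0 rb nb i; have := ng_le0 rc nc i; nra.
apply/negbTE/ng_ge0 => i; rewrite dE !coE.
have := ngN_ge0 (negbT nb) i; have := ngN_ge0 (negbT nc) i; nra.
Qed.

Lemma co_sg i b j : j != i -> co (simple_refl m i b) j = co b j.
Proof.
by move=> ji; rewrite /simple_refl /refl !coE co_bas (eq_sym i) (negbTE ji) mulr0 subr0.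
Qed.

Lemma pos_root_simple i b : root b -> ~~ negative b ->
  (forall j, j != i -> co b j = 0) -> b = alpha i.
Proof.
move=> rb pb b0; have bE : b = co b i *: alpha i.
  apply/coP => j; rewrite coZ co_bas eq_sym.
  by have [->|ji] := eqVneq j i; rewrite ?mulr1 // mulr0 b0.
have := form_root rb; rewrite bE formZl formZr form_ii mulr1.
have := ngN_ge0 pb i => x0 /eqP; rewrite -expr2 sqrf_eq1 => /orP[]/eqP xE.
  by rewrite xE scale1r.
by exfalso; move: x0; rewrite xE; lra.
Qed.

(** A positive root other than [alpha i] has a positive coordinate that the
    reflection in [alpha i] does not change. *)
Lemma ng_sg i b : root b -> ~~ negative b -> b != alpha i -> ~~ negative (simple_refl m i b).
Proof.
move=> rb pb bi; apply/negP => nb.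
have rs : root (simple_refl m i b) by rewrite -act_f; apply: root_act.
move/eqP: bi; apply; apply: pos_root_simple => // j ji.
apply/eqP; rewrite eq_le ngN_ge0 // andbT -(co_sg _ ji); exact: ng_le0.
Qed.

(** A word for g followed by a word for h is reduced when no wall is crossed in
    both halves. *)
Lemma add_lenP g h : len (g * h) = (len g + len h)%N <->
  (forall b, root b -> ~~ negative b -> negative (act g b) -> ~~ negative (act h^-1 b)).
Proof.
have [n] := ubnP (len h); elim: n g h => // n IH g h hn.
have [->|h1] := eqVneq h 1%g.
  by rewrite mulg1 invg1 len1 addn0; split=> // _ b rb pb _; rewrite act1.
have [i hi] := left_descent f2 fgen h1.
pose h' := (f i * h)%g.
have hE : h = (f i * h')%g by rewrite /h' cox_genK.
have h'V b : act h'^-1 b = act h^-1 (simple_refl m i b).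
  by rewrite /h' invgM (fV f2) actM act_f.
have {}IH := IH (g * f i)%g h'.
have ghE : (g * f i * h')%g = (g * h)%g by rewrite -mulgA -hE.
have l' : (len h = (len h').+1) by rewrite /h' hi.
have {}IH := IH ltac:(lia).
have nhi : negative (act h^-1 (alpha i)).
  rewrite ng_act (lenV f2 fgen) -hi -[(_ * f i)%g]invgK (lenV f2 fgen).
  by rewrite invgM invgK (fV f2).
split=> [E|H].
  have gi : len (g * f i) = (len g).+1.
    have := lenM fgen (g * f i) h'; rewrite ghE E.
    by have [] := len_Mf_cases g i; lia.
  have {}IH := IH.1 ltac:(rewrite ghE; lia).
  move=> b rb pb ngb; have [bi|bi] := eqVneq b (alpha i).
    by move: ngb; rewrite bi ng_act; lia.
  have := IH (simple_refl m i b); rewrite h'V actM act_f /simple_refl reflK ?form_ii // -/(simple_refl m i b).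
  apply=> //; last exact: ng_sg.
  by rewrite -act_f; apply: root_act.
have gi : ~~ negative (act g (alpha i)).
  apply/negP => ngi; have := H (alpha i) (root_simple i).
  by rewrite ng_simple nhi => /(_ isT ngi).
have lgi : len (g * f i) = (len g).+1.
  by move: gi; rewrite ng_act; have [] := len_Mf_cases g i; lia.
rewrite -ghE IH.2 ?lgi; first by lia.
move=> b rb pb; rewrite actM act_f h'V => ngb.
have [bi|bi] := eqVneq b (alpha i).
  rewrite bi /simple_refl refl_self ?form_ii // actN ng_opp ?nhi //.
  exact/root_act/root_simple.
apply: H ngb; last exact: ng_sg.
by rewrite -act_f; apply: root_act.
Qed.

(** The roots made negative by a word are carried to the successive simple roots
    of its letters. *)
Lemma inv_finite g : exists2 s : seq V, (size s <= len g)%N &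
  forall b, root b -> ~~ negative b -> negative (act g b) -> b \in s.
Proof.
have [w <- <-] := len_wit fgen g; elim: w => [|i w [s sw sP]].
  by exists [::] => // b rb /negbTE pb; rewrite act_ev /= pb.
exists (act (ev w)^-1 (alpha i) :: s) => //= b rb pb nb.
rewrite in_cons; have [nw|pw] := boolP (negative (act (ev w) b)).
  by rewrite sP ?orbT.
suff : act (ev w) b = alpha i by move<-; rewrite actK eqxx.
apply: contraTeq nb => bi; rewrite ev_cons actM act_f.
by apply: ng_sg => //; apply: root_act.
Qed.

Lemma act_faithful g : (forall v, act g v = v) -> g = 1%g.
Proof.
move=> H; apply/eqP; apply: contrapT => /negP g1.
have [i gi] := right_descent f2 fgen g1.
by have := ng_act g i; rewrite H ng_simple -gi ltnSn.
Qed.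

Lemma reflection_elt b : root b -> exists t, forall v, act t v = refl m b v.
Proof.
move=> [g [i ->]]; exists (g * f i * g^-1)%g => // v.
rewrite !actM act_f /simple_refl /refl actD actN actZ actVK.
by rewrite -(form_act g) actVK.
Qed.

(** * Dominance *)

Definition pos_root b := root b /\ ~~ negative b.

Lemma root_refl b c : root b -> root c -> root (refl m b c).
Proof. by move=> rb rc; have [t <-] := reflection_elt rb; apply: root_act. Qed.

Definition height (v : V) : R := \sum_i co v i.

Lemma htD u v : height (u + v) = height u + height v.
Proof. by rewrite /height -big_split; apply: eq_bigr => i _; rewrite coE. Qed.

Lemma htZ a v : height (a *: v) = a * height v.
Proof. by rewrite /height mulr_sumr; apply: eq_bigr => i _; rewrite coE. Qed.

Lemma htN v : height (- v) = - height v.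
Proof. by rewrite -scaleN1r htZ mulN1r. Qed.

Lemma ht_gt0 b : root b -> ~~ negative b -> 0 < height b.
Proof.
move=> rb pb; have [i bi] := vec_neq0 (root_neq0 rb).
rewrite /height (bigD1 i) //= ltr_pwDl //; first by rewrite lt_neqAle eq_sym bi ngN_ge0.
by apply: sumr_ge0 => j _; apply: ngN_ge0.
Qed.

Lemma ht_lt0 b : root b -> negative b -> height b < 0.
Proof.
move=> rb nb; rewrite -oppr_gt0 -htN; apply: ht_gt0; first exact: rootN.
by rewrite ng_opp // negbK.
Qed.

Lemma inv_noinj g (Z : nat -> V) : injective Z -> (forall n, pos_root (Z n)) ->
  (forall n, negative (act g (Z n))) -> False.
Proof.
move=> injZ pZ nZ; have [s ss sP] := inv_finite g.
have u : uniq (map Z (iota 0 (size s).+1)) by rewrite map_inj_uniq // iota_uniq.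
have sub : {subset map Z (iota 0 (size s).+1) <= s}.
  by move=> _ /mapP[n _ ->]; have [rn pn] := pZ n; apply: sP.
by have := uniq_leq_size u sub; rewrite size_map size_iota ltnn.
Qed.

Lemma incr_inj (x : nat -> R) : (forall n, x n < x n.+1) -> injective x.
Proof.
move=> H; have lt_x p n : (p < n)%N -> x p < x n.
  elim: n => // n IH; rewrite ltnS leq_eqVlt => /orP[/eqP->//|/IH h].
  exact: lt_trans h (H n).
by move=> p n E; have [/lt_x|/lt_x|//] := ltngtP p n; rewrite E ltxx.
Qed.

(** For positive roots this says that the wall of c separates the wall of b from
    1, unless b = c. *)
Definition dominates b c := forall w, negative (act w b) -> negative (act w c).

Lemma dom_refl b : dominates b b. Proof. by move=> w. Qed.
Lemma dom_trans b c d : dominates b c -> dominates c d -> dominates b d.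
Proof. by move=> bc cd w /bc/cd. Qed.

(** If neither root dominates the other, then b and c can be given opposite signs
    in both ways, by w1 and w2. Reflecting alternately in b and c produces
    infinitely many roots p c - q b with p and q nonnegative, as the coefficients
    grow when the form is at least 1 at (b, c). All of them are positive after w1
    and negative after w2, whereas only finitely many roots change sign. *)
Lemma dom_total b c : pos_root b -> pos_root c -> 1 <= B b c -> dominates b c \/ dominates c b.
Proof.
move=> [rb pb] [rc pc] bc; apply: contrapT => /not_orP[].
move=> /existsNP[w1 /not_implyP[nb1 /negP pc1]] /existsNP[w2 /not_implyP[nc2 /negP pb2]].
pose rho v := refl m c (refl m b v); pose z n := iter n rho c.
have rz n : root (z n) by elim: n => //= n IH; do 2!apply: root_refl => //.
have grow p q : 0 <= q -> q < p -> p < 2 * B b c * p - q.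
  move=> q0 qp; have : p <= B b c * p by rewrite ler_peMl //; lra.
  by lra.
(* one turn of the dihedral rotation, in coordinates *)
have step p q : refl m c (refl m b (p *: c - q *: b)) =
   (2 * B b c * (2 * B b c * p - q) - p) *: c - (2 * B b c * p - q) *: b.
  by rewrite /refl !formE (formC m c b) !form_root //; vec; ring.
have zE n : exists p q, [/\ z n = p *: c - q *: b,
    z n.+1 = (2 * B b c * (2 * B b c * p - q) - p) *: c - (2 * B b c * p - q) *: b,
    0 <= q & q < p].
  elim: n => [|n [p [q [zn zn' q0 qp]]]].
    have z0 : z 0%N = 1 *: c - 0 *: b by rewrite /z /= scale1r scale0r subr0.
    by exists 1, 0; split=> //; rewrite -step -z0.
  exists (2 * B b c * (2 * B b c * p - q) - p), (2 * B b c * p - q).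
  have pq := grow _ _ q0 qp; have p0 : 0 <= p by lra.
  have zn2 : z n.+2 = refl m c (refl m b (z n.+1)) by [].
  split=> //; last by apply: grow.
    by rewrite zn2 zn' step.
  by lra.
have nc1 : ~~ negative (- act w1 b) by rewrite ng_opp ?nb1 //; apply: root_act.
have nb2 : negative (- act w2 b) by rewrite ng_opp ?pb2 //; apply: root_act.
have rN w : root (- act w b) by apply/rootN/root_act.
have actz w p q : act w (p *: c - q *: b) = p *: act w c + q *: - act w b.
  by rewrite actD actN !actZ; vec; ring.
have incr n : height (act w1 (z n)) < height (act w1 (z n.+1)).
  have [p [q [zn zn' q0 qp]]] := zE n.
  have pq := grow _ _ q0 qp; have p0 : 0 <= p by lra.
  have pp' := grow _ _ p0 pq.
  rewrite zn' zn !actz !htD !htZ; apply: ltrD.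
    by rewrite ltr_pM2r ?ht_gt0 //; [lra | apply: root_act].
  by rewrite ltr_pM2r ?ht_gt0 //; lra.
apply: (@inv_noinj (w2 * w1^-1) (fun n => act w1 (z n))).
- move=> k n kn; apply: (incr_inj incr); congr (height _); exact: kn.
- move=> n; split; first exact: root_act.
  have [p [q [zn _ q0 qp]]] := zE n; have p0 : 0 <= p by lra.
  have rr := root_act w1 (rz n); rewrite zn actz in rr *.
  by rewrite (ng_comb (root_act w1 rc) (rN w1) rr p0 q0 erefl (negbTE pc1) (negbTE nc1)).
- move=> n; have [p [q [zn _ q0 qp]]] := zE n; have p0 : 0 <= p by lra.
  have rr := root_act w2 (rz n); rewrite -actM mulgVK zn actz in rr *.
  by rewrite (ng_comb (root_act w2 rc) (rN w2) rr p0 q0 erefl nc2 nb2).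
Qed.

(** Just before the last step of a shortest path that makes b negative, both b and
    c become the simple root of that step. *)
Lemma dom_antisym b c : pos_root b -> pos_root c -> dominates b c -> dominates c b -> b = c.
Proof.
move=> [rb pb] [rc pc] bc cb.
have [w wb] : exists w, negative (act w b).
  have [t tE] := reflection_elt rb; exists t.
  by rewrite tE refl_self ?form_root // ng_opp.
have [n] := ubnP (len w); elim: n w wb => // n IH w wb wn.
have w1 : w != 1%g by apply: contraNneq pb => w1; rewrite w1 act1 in wb.
have [i wi] := left_descent (pres_f2) (pres_gen) w1.
have wE v : act w v = simple_refl m i (act (f i * w) v) by rewrite -act_f -actM cox_genK.
have [nb|pb'] := boolP (negative (act (f i * w) b)); first by apply: (IH _ nb); lia.
have pc' : ~~ negative (act (f i * w) c) by apply: contra pb' => /cb.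
have eqs d : root d -> ~~ negative (act (f i * w) d) -> negative (act w d) ->
    act (f i * w) d = alpha i.
  move=> rd pd; apply: contraTeq => di; rewrite wE.
  by apply: ng_sg => //; apply: root_act.
have : act (f i * w) b = act (f i * w) c.
  by rewrite (eqs b rb pb' wb) (eqs c rc pc' (bc w wb)).
by move/(congr1 (act (f i * w)^-1)); rewrite !actK.
Qed.

(** No wall separates the wall of b from 1. These are the small, or elementary,
    roots of Brink and Howlett. *)
Definition small b := pos_root b /\ forall c, pos_root c -> dominates b c -> c = b.

Lemma small_form b c : small b -> small c -> b != c -> B b c < 1.
Proof.
move=> [pb sb] [pc sc] bc; rewrite ltNge; apply/negP => /dom_total[]// d.
  by move/eqP: bc; apply; rewrite (sb c).
by move/eqP: bc; apply; rewrite (sc b).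
Qed.

Lemma proot_simple i : pos_root (alpha i).
Proof. by split; [exact: root_simple | rewrite ng_simple]. Qed.

Lemma dom_simple i c : pos_root c -> dominates (alpha i) c -> c = alpha i.
Proof.
move=> [rc pc] /(_ (f i)); rewrite act_f /simple_refl refl_self ?form_ii //.
rewrite ng_opp ?ng_simple; last exact: root_simple.
move=> /(_ isT); apply: contraTeq => ci; rewrite act_f; exact: ng_sg.
Qed.

Lemma small_simple i : small (alpha i).
Proof. by split; [exact: proot_simple | exact: dom_simple]. Qed.

(** Let b' be the reflected root. A root dominated by b' gives one dominated by b
    after reflection in [alpha i], unless it is [alpha i] itself. In that last
    case the reflection in b', whose form with [alpha i] is negative, makes b'
    negative and keeps [alpha i] positive. *)
Lemma small_desc b i : small b -> 0 < B b (alpha i) -> b != alpha i ->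
  small (simple_refl m i b).
Proof.
move=> [[rb pb] sb] bi bni.
have rs : root (simple_refl m i b) by rewrite -act_f; apply: root_act.
split=> [|c [rc pc] d]; first by split=> //; apply: ng_sg.
have [ci|ci] := eqVneq c (alpha i).
  have [t tE] := reflection_elt rs.
  have := d t; rewrite !tE refl_self ?form_root // ng_opp // ng_sg // => /(_ isT).
  have ri := root_simple i; have rt : root (act t c) by apply: root_act.
  have sE : B (alpha i) (simple_refl m i b) = - B b (alpha i).
    by rewrite /simple_refl /refl !formE form_ii (formC m (alpha i)); ring.
  have := @ng_comb _ _ (act t c) 1 (2 * B b (alpha i)) false ri rs rt.
  rewrite -tE ler01 => -> //.
  - by rewrite mulr_ge0 ?ltW.
  - by rewrite tE ci {1}/refl sE scale1r; vec; ring.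
  - exact: ng_simple.
  - by apply/negbTE/ng_sg.
have E : simple_refl m i c = b.
  apply: sb; first by split; [rewrite -act_f; apply: root_act | apply: ng_sg].
  move=> w wb; rewrite -act_f -actM; apply: d.
  by rewrite -act_f -actM cox_genKr.
by rewrite -E /simple_refl reflK // form_ii.
Qed.

(** * Crossing walls and the values of the form *)

(** The ratio of consecutive terms drops by at least 2 - t at each step, since
    r + 1/r is at least 2. *)
Lemma linrec_not_pos (x : nat -> R) (t : R) N : t < 2 ->
  (forall n, x n.+2 = t * x n.+1 - x n) -> (forall n, (N <= n)%N -> 0 < x n) -> False.
Proof.
move=> t2 rec pos; pose r n := x (N + n).+1 / x (N + n)%N.
have x0 n : 0 < x (N + n)%N by apply: pos; rewrite leq_addr.
have x1 n : 0 < x (N + n).+1 by apply: pos; rewrite leqW ?leq_addr.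
have r0 n : 0 < r n by rewrite divr_gt0.
have rS n : r n.+1 <= r n - (2 - t).
  have rE : r n.+1 = t - (r n)^-1.
    rewrite /r addnS rec invf_div mulrBl mulfK ?gt_eqF //.
  rewrite rE.
  suff : 2 <= r n + (r n)^-1 by lra.
  have rn := r0 n; have : r n * (r n)^-1 = 1 by rewrite divff ?gt_eqF.
  have : 0 < (r n)^-1 by rewrite invr_gt0.
  move: (r n)^-1 => y y0 ry.
  have : 0 <= (r n - 1) ^+ 2 * y by rewrite mulr_ge0 ?sqr_ge0 ?ltW.
  have -> : (r n - 1) ^+ 2 * y = r n * (r n * y) - 2 * (r n * y) + y by ring.
  by rewrite ry; lra.
clearbody r.
have rn n : r n <= r 0%N - n%:R * (2 - t).
  elim: n => [|n IH]; first by rewrite mul0r subr0.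
  have h := rS n; have -> : n.+1%:R * (2 - t) = n%:R * (2 - t) + (2 - t).
    by rewrite -natr1 mulrDl mul1r.
  move: (n%:R * (2 - t)) IH => y IH; lra.
have [n nP] : exists n, r 0%N < n%:R * (2 - t).
  have d0 : 0 < 2 - t by lra.
  exists (Num.truncn (r 0%N / (2 - t))).+1.
  by rewrite -ltr_pdivrMr // truncnS_gt.
by have := rn n; have := r0 n; lra.
Qed.

(** The heights of the roots of the orbit satisfy a recurrence that forces
    infinitely many sign changes. Were the orbit infinite, the changes from
    positive to negative would give infinitely many positive roots made negative
    by r. *)
Lemma root_period (r : W) v t : root v -> t < 2 ->
  act r (act r v) = t *: act r v - v -> exists2 k, (0 < k)%N & act (r ^+ k) v = v.
Proof.
move=> rv t2 rec; apply: contrapT => noper.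
pose u n := act (r ^+ n) v.
have uS n : u n.+1 = act r (u n) by rewrite /u expgS actM.
have urec n : u n.+2 = t *: u n.+1 - u n.
  have -> : u n.+2 = act (r ^+ n) (act r (act r v)).
    by rewrite /u -!actM -mulgA -expg2 -expgnDr addn2.
  by rewrite rec actD actN actZ -actM -expgSr.
have ru n : root (u n) by apply: root_act.
have uinj : injective u.
  have lt_u p n : (p < n)%N -> u p <> u n.
    move=> pn E; apply: noper; exists (n - p)%N; first by rewrite subn_gt0.
    have : act (r ^+ p)^-1 (u n) = v by rewrite -E /u actK.
    by rewrite /u -actM => {2}<-; rewrite -{2}(subnKC (ltnW pn)) expgnDr mulKg.
  by move=> p n E; have [/lt_u|/lt_u|//] := ltngtP p n; rewrite E.
have hrec n : height (u n.+2) = t * height (u n.+1) - height (u n).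
  by rewrite urec htD htN htZ.
have exneg N : exists2 n, (N <= n)%N & negative (u n).
  apply: contrapT => H; apply: (@linrec_not_pos (fun n => height (u n)) t N t2 hrec) => n Nn.
  by apply: ht_gt0 => //; apply/negP => nn; apply: H; exists n.
have expos N : exists2 n, (N <= n)%N & ~~ negative (u n).
  apply: contrapT => H; apply: (@linrec_not_pos (fun n => - height (u n)) t N t2).
    by move=> n; rewrite hrec; ring.
  move=> n Nn; rewrite oppr_gt0; apply: ht_lt0 => //.
  by apply: contrapT => /negP nn; apply: H; exists n.
have change N : exists n, [/\ (N <= n)%N, ~~ negative (u n) & negative (u n.+1)].
  have [p Np pp] := expos N; have [q pq nq] := exneg p.
  have Ex : exists n, (p <= n)%N && negative (u n) by exists q; rewrite pq.
  case: (ex_minnP Ex) => -[|n] /andP[pn nn] nmin.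
    by move: pn pp; rewrite leqn0 => /eqP->; rewrite nn.
  have pn' : (p <= n)%N.
    by move: pn; rewrite leq_eqVlt => /orP[/eqP E|//]; rewrite E nn in pp.
  exists n; split=> //; first exact: leq_trans pn'.
  by apply/negP => nn'; have := nmin n; rewrite pn' nn' => /(_ isT); rewrite ltnn.
pose nextc N := sval (cid (change N)).
pose idx := fix idx n := if n is n'.+1 then nextc (idx n').+1 else nextc 0%N.
have nextcP N : [/\ (N <= nextc N)%N, ~~ negative (u (nextc N)) & negative (u (nextc N).+1)].
  exact: svalP (cid (change N)).
have idxP n : ~~ negative (u (idx n)) /\ negative (u (idx n).+1).
  by case: n => [|n]; [have [] := nextcP 0%N | have [] := nextcP (idx n).+1].
have idxS n : (idx n < idx n.+1)%N by have [] := nextcP (idx n).+1.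
have idx_lt p n : (p < n)%N -> (idx p < idx n)%N.
  elim: n => // n IH; rewrite ltnS leq_eqVlt => /orP[/eqP->//|/IH h].
  exact: ltn_trans h (idxS n).
apply: (@inv_noinj r (fun n => u (idx n))).
- move=> p n /uinj E; have [/idx_lt|/idx_lt|//] := ltngtP p n; lia.
- by move=> n; split=> //; have [] := idxP n.
- by move=> n; rewrite -uS; have [] := idxP n.
Qed.

Lemma sum_shift (F : nat -> R) k : F k = F 0%N ->
  \sum_(l <- iota 0 k) F l.+1 = \sum_(l <- iota 0 k) F l.
Proof.
move=> F0; case: k F0 => [|k] F0; first by rewrite !big_nil.
have iE : iota 0 k.+1 = index_iota 0 k.+1 by rewrite /index_iota subn0.
by rewrite iE [RHS]big_nat_recl // [LHS]big_nat_recr //= F0 addrC.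
Qed.

Definition orbit_ht (D : seq W) (v : V) : R := \sum_(d <- D) height (act d v).

Lemma orbit_htZ D a v : orbit_ht D (a *: v) = a * orbit_ht D v.
Proof. by rewrite /orbit_ht mulr_sumr; apply: eq_bigr => d _; rewrite actZ htZ. Qed.

Lemma orbit_htD D u v : orbit_ht D (u + v) = orbit_ht D u + orbit_ht D v.
Proof. by rewrite /orbit_ht -big_split; apply: eq_bigr => d _; rewrite actD htD. Qed.

Lemma orbit_htN D v : orbit_ht D (- v) = - orbit_ht D v.
Proof. by rewrite -scaleN1r orbit_htZ mulN1r. Qed.

(** The product of the two reflections has finite order, and the sum of the
    heights over the finite dihedral group is invariant under both reflections,
    which change the signs of b and c. *)
Lemma dihedral_avg b c : root b -> root c -> -1 < B b c < 1 ->
  exists D, [/\ D != [::], orbit_ht D b = 0 & orbit_ht D c = 0].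
Proof.
move=> rb rc bc; have [tb tbE] := reflection_elt rb; have [tc tcE] := reflection_elt rc.
pose r := (tc * tb)%g; pose t := 4 * B b c ^+ 2 - 2.
have rE v : act r v = refl m c (refl m b v) by rewrite /r actM tcE tbE.
have t2 : t < 2 by rewrite /t; have /andP[] := bc; nra.
have bb := form_root rb; have cc := form_root rc.
(* the rotation by twice the angle between b and c satisfies its
   characteristic equation *)
have rec v : v = b \/ v = c -> act r (act r v) = t *: act r v - v.
  by case=> ->; rewrite !rE /refl !formE ?(formC m c b) bb cc; vec; rewrite /t; ring.
have [k1 k10 k1b] := root_period rb t2 (rec b (or_introl erefl)).
have [k2 k20 k2c] := root_period rc t2 (rec c (or_intror erefl)).
pose k := (k1 * k2)%N.
have fixX n (g : W) v : act g v = v -> act (g ^+ n) v = v.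
  by move=> gv; elim: n => [|n IH]; rewrite ?act1 // expgS actM IH.
have kb : act (r ^+ k) b = b by rewrite /k expgnA fixX.
have kc : act (r ^+ k) c = c by rewrite /k mulnC expgnA fixX.
have plane n v : exists x y, act (r ^+ n) v = v + x *: b + y *: c.
  elim: n => [|n [x [y E]]]; first by exists 0, 0; rewrite act1 !scale0r !addr0.
  rewrite expgS actM E rE /refl.
  set p := 2 * form m _ b; set q := 2 * form m _ c.
  by exists (x - p), (y - q); vec; ring.
have kid v : act (r ^+ k) v = v.
  have [x [y E]] := plane k v.
  by apply: (@isometry_plane _ _ m _ b c v x y); rewrite // => u w; rewrite form_act.
pose D := map (fun l => r ^+ l)%g (iota 0 k) ++ map (fun l => r ^+ l * tb)%g (iota 0 k).
have qE v : orbit_ht D v = \sum_(l <- iota 0 k) height (act (r ^+ l) v) +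
    \sum_(l <- iota 0 k) height (act (r ^+ l * tb) v).
  by rewrite /orbit_ht /D big_cat !big_map.
have tbK v : act tb (act tb v) = v by rewrite !tbE reflK.
have tcK v : act tc (act tc v) = v by rewrite !tcE reflK.
have qb v : orbit_ht D (act tb v) = orbit_ht D v.
  rewrite !qE addrC; congr (_ + _); apply: eq_bigr => l _; last by rewrite actM.
  by rewrite actM tbK.
have qc v : orbit_ht D (act tc v) = orbit_ht D v.
  rewrite !qE addrC; congr (_ + _).
    rewrite -(@sum_shift (fun l => height (act (r ^+ l * tb) (act tc v)))).
      by apply: eq_bigr => l _; rewrite expgSr !actM /r ?actM tbK tcK.
    by rewrite !actM kid act1.
  rewrite -(@sum_shift (fun l => height (act (r ^+ l * tb) v))).
    by apply: eq_bigr => l _; rewrite expgSr !actM /r ?actM tbK.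
  by rewrite !actM kid act1.
have q0 v : orbit_ht D (- v) = orbit_ht D v -> orbit_ht D v = 0.
  by rewrite orbit_htN; lra.
exists D; split.
- have k0 : (0 < k)%N by rewrite muln_gt0 k10.
  by rewrite -size_eq0 size_cat !size_map size_iota; lia.
- by apply: q0; rewrite -[in RHS]qb tbE refl_self.
- by apply: q0; rewrite -[in RHS]qc tcE refl_self.
Qed.

Lemma orbit_le0_finite D w : D != [::] -> exists s : seq V,
  forall a, pos_root a -> orbit_ht D (act w a) <= 0 -> a \in s.
Proof.
move=> D0; have [s sP] : exists s : seq V, forall a, pos_root a ->
    (exists2 d, d \in D & negative (act (d * w) a)) -> a \in s.
  elim: D {D0} => [|d D [s sP]]; first by exists [::] => a _ [].
  have [s' _ s'P] := inv_finite (d * w); exists (s' ++ s) => a pa [e].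
  rewrite in_cons mem_cat => /orP[/eqP->|eD] ne.
    by case: pa => ra pa; rewrite s'P.
  by rewrite sP ?orbT //; exists e.
exists s => a pa q0; apply: sP => //; apply: contrapT => H.
have pos d : d \in D -> 0 < height (act d (act w a)).
  move=> dD; have [ra _] := pa; rewrite -actM; apply: ht_gt0; first exact: root_act.
  by apply/negP => nd; apply: H; exists d.
case: D D0 q0 pos {H} => // d D _; rewrite /orbit_ht big_cons => q0 pos.
have : 0 <= \sum_(e <- D) height (act e (act w a)).
  rewrite big_seq; apply: sumr_ge0 => e eD; apply/ltW/pos.
  by rewrite in_cons eD orbT.
have := pos d; rewrite in_cons eqxx => /(_ isT); lra.
Qed.

(** If the functional is negative at w (alpha i), replacing w by w * f i removes
    one root from the finite set where it is negative. *)
Lemma orbit_dominant D : D != [::] ->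
  exists w, forall i, 0 <= orbit_ht D (act w (alpha i)).
Proof.
move=> D0; have [s sP] := orbit_le0_finite 1%g D0.
have {sP} : forall a, pos_root a -> orbit_ht D (act 1%g a) < 0 -> a \in s.
  by move=> a pa /ltW; apply: sP.
have [n] := ubnP (size s); move: 1%g => w.
elim: n w s => // n IH w s sn sP.
have [[i qi]|H] := pselect (exists i, orbit_ht D (act w (alpha i)) < 0); last first.
  by exists w => i; rewrite leNgt; apply/negP => qi; apply: H; exists i.
apply: (IH (w * f i)%g (map (simple_refl m i) (rem (alpha i) s))).
  have si := sP _ (proot_simple i) qi.
  by rewrite size_map size_rem //; case: (s) si sn.
move=> a [ra pa]; rewrite actM act_f => qa.
have ai : a != alpha i.
  apply/eqP => ai; move: qa; rewrite ai /simple_refl refl_self ?form_ii // actN orbit_htN.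
  by rewrite oppr_lt0 ltNge ltW.
have psa : pos_root (simple_refl m i a) by split; [rewrite -act_f; apply: root_act | apply: ng_sg].
have sgK (v : V) : simple_refl m i (simple_refl m i v) = v by rewrite /simple_refl reflK // form_ii.
apply/mapP; exists (simple_refl m i a) => //.
have : simple_refl m i a != alpha i.
  apply/eqP => E; move: pa; have := sgK a; rewrite E /simple_refl refl_self ?form_ii // => <-.
  by rewrite ng_opp ?ng_simple //; apply: root_simple.
by move=> sai; have := sP _ psa qa; rewrite (perm_mem (perm_to_rem (sP _ (proot_simple i) qi))) in_cons (negbTE sai).
Qed.

Definition supp_in (J : {set I}) b := forall i, co b i != 0 -> i \in J.

Definition fin_parabolic (J : {set I}) :=
  exists s : seq V, forall b, root b -> supp_in J b -> b \in s.

(** The averaged height vanishes at b and c. Conjugate it to be nonnegative on the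
    simple roots: then b and c are carried to roots supported by the simple roots
    where it vanishes, and there are finitely many such roots. *)
Lemma crossing_parabolic b c : root b -> root c -> -1 < B b c < 1 ->
  exists w J, [/\ fin_parabolic J, supp_in J (act w b) & supp_in J (act w c)].
Proof.
move=> rb rc bc; have [D [D0 qb qc]] := dihedral_avg rb rc bc.
have [w wP] := orbit_dominant D0.
pose J := [set i | orbit_ht D (act w (alpha i)) == 0].
have qsum v : orbit_ht D (act w v) = \sum_i co v i * orbit_ht D (act w (alpha i)).
  rewrite act_sum; elim/big_rec2: _ => [|i y1 y2 _ <-].
    by rewrite -[0](scale0r 0) orbit_htZ mul0r.
  by rewrite orbit_htD orbit_htZ.
have supp d : root d -> orbit_ht D d = 0 -> supp_in J (act w^-1 d).
  move=> rd qd i di; rewrite inE.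
  have rd' : root (act w^-1 d) by apply: root_act.
  have := qsum (act w^-1 d); rewrite actVK qd => /esym/eqP.
  set e := act w^-1 d in di rd' *.
  have [pe|ne] := root_cases rd'.
    rewrite psumr_eq0 => [/allP/(_ i)|j _]; last by rewrite mulr_ge0.
    by rewrite mem_index_enum mulf_eq0 (negbTE di) => /(_ isT).
  rewrite -oppr_eq0 -sumrN psumr_eq0 => [/allP/(_ i)|j _].
    by rewrite mem_index_enum oppr_eq0 mulf_eq0 (negbTE di) => /(_ isT).
  by rewrite -mulNr mulr_ge0 // oppr_ge0.
exists w^-1%g, J; split; [|exact: supp|exact: supp].
have [s sP] := orbit_le0_finite w D0; exists (s ++ map -%R s) => d rd sd.
have qd : orbit_ht D (act w d) = 0.
  rewrite qsum big1 // => i _; have [->|di] := eqVneq (co d i) 0; first by rewrite mul0r.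
  by have := sd i di; rewrite inE => /eqP->; rewrite mulr0.
rewrite mem_cat; have [nd|pd] := boolP (negative d); last by rewrite sP ?qd.
apply/orP; right; rewrite -[d]opprK map_f // sP //.
  by split; [apply: rootN | rewrite ng_opp // negbK].
by rewrite actN orbit_htN qd oppr0.
Qed.

(** By invariance of the form, only the values on the finitely many finite
    parabolic subsystems occur. *)
Lemma form_values_finite : exists F : seq R, forall b i, root b ->
  -1 < B b (alpha i) < 1 -> B b (alpha i) \in F.
Proof.
pose lst (J : {set I}) : seq V :=
  if pselect (fin_parabolic J) is left e then sval (cid e) else [::].
have lstP J b : fin_parabolic J -> root b -> supp_in J b -> b \in lst J.
  by move=> fJ; rewrite /lst; case: pselect => [e|//]; case: cid => s /= sP; apply: sP.
exists (flatten [seq [seq B x y | x <- lst J, y <- lst J] | J <- enum {set I}]).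
move=> b i rb bi; have [w [J [fJ sb si]]] := crossing_parabolic rb (root_simple i) bi.
apply/flattenP; exists [seq B x y | x <- lst J, y <- lst J].
  by apply/mapP; exists J; rewrite ?mem_enum.
rewrite -(form_act w); apply: allpairs_f; apply: lstP => //; apply: root_act => //.
exact: root_simple.
Qed.

(** * Finiteness of small roots *)

(** The indices go down: [d 0] is the deepest root of the chain. *)
Definition descent (d : nat -> V) (l : nat -> I) n :=
  (forall k, (k <= n)%N -> small (d k)) /\
  (forall k, (k < n)%N -> d k.+1 = simple_refl m (l k) (d k) /\ 0 < B (d k) (alpha (l k))).

Lemma small_lt1 b i : small b -> b != alpha i -> B b (alpha i) < 1.
Proof. by move=> sb bi; apply: small_form => //; apply: small_simple. Qed.

Lemma form_sg b i j :
  B (simple_refl m i b) (alpha j) = B b (alpha j) - 2 * B b (alpha i) * B (alpha i) (alpha j).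
Proof. by rewrite /simple_refl /refl !formE; ring. Qed.

Lemma form_sgi b i : B (simple_refl m i b) (alpha i) = - B b (alpha i).
Proof. by rewrite form_sg form_ii; ring. Qed.

Lemma descent_neq d l n k : descent d l n -> (k < n)%N -> d k != alpha (l k).
Proof.
move=> [sm st] kn; apply/eqP => dk; have [E _] := st k kn.
have [[_ p] _] := sm k.+1 kn; move: p; rewrite E dk /simple_refl refl_self ?form_ii //.
by rewrite ng_opp ?ng_simple //; apply: root_simple.
Qed.

Lemma descent_diff d l n p q : descent d l n -> (p <= q <= n)%N ->
  forall i, co (d q) i <= co (d p) i /\
   (co (d q) i < co (d p) i -> exists2 k, (p <= k < q)%N & l k = i).
Proof.
move=> [sm st]; elim: q => [|q IH] /andP[pq qn] i.
  by move: pq; rewrite leqn0 => /eqP->; rewrite lexx ltxx.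
move: pq; rewrite leq_eqVlt => /orP[/eqP<-|]; first by rewrite lexx ltxx.
rewrite ltnS => pq; have [|le ex] := IH _ i; first by rewrite pq ltnW.
have [E p0] := st q qn; have [il|il] := eqVneq i (l q).
  split; last by move=> _; exists q; rewrite // pq ltnSn.
  apply: le_trans le; rewrite E /simple_refl /refl !coE co_bas il eqxx mulr1; lra.
rewrite E co_sg //; split=> // /ex[k /andP[pk kq] lk].
by exists k; rewrite // pk ltnW.
Qed.

(** Climbing from [d k.+1] to [d k] adds a positive multiple of another simple root,
    which can only decrease the form with [alpha i]. Climbing along i itself
    would need a value above -1, because [d k] is small. *)
Lemma descent_sticky d l n p q i : descent d l n -> (p <= q <= n)%N ->
  B (d q) (alpha i) <= -1 -> forall k, (p <= k < q)%N -> l k != i.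
Proof.
move=> D /andP[pq qn] dq; have [sm st] := D.
suff H e : (e <= q)%N -> B (d (q - e)%N) (alpha i) <= -1 /\
    forall k, (q - e <= k < q)%N -> l k != i.
  by have [|_] := H (q - p)%N; rewrite ?leq_subr // subKn.
elim: e => [|e IH] eq.
  by rewrite subn0; split=> // k /andP[qk kq]; move: (leq_trans kq qk); rewrite ltnn.
have [{}IH IHk] := IH (ltnW eq); set k := (q - e.+1)%N.
have kS : (q - e)%N = k.+1 by rewrite /k; lia.
have kn : (k < n)%N by rewrite /k; lia.
have [E p0] := st k kn; have lt1 := small_lt1 (sm k (ltnW kn)) (descent_neq D kn).
rewrite kS in IH.
have E' : d k = simple_refl m (l k) (d k.+1) by rewrite E /simple_refl reflK // form_ii.
have lki : l k != i.
  by apply/eqP => lki; move: IH; rewrite -{1}lki E form_sgi; lra.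
split; last first.
  move=> r /andP[kr rq]; move: kr; rewrite leq_eqVlt => /orP[/eqP<-//|kr].
  by apply: IHk; rewrite kS kr.
rewrite E' form_sg form_bas /cartan (negbTE lki).
have := cartan_le0 R m lki; rewrite /cartan (negbTE lki).
move: IH p0; rewrite E form_sgi => h1 h2 h3; nra.
Qed.

(** Record for each simple root the value of the form, truncated below -1; this
    takes finitely many values. If two roots of the chain have the same record,
    their difference is supported by simple roots to which it is orthogonal. So
    it is isotropic, and then the form is 1 at the two roots, which contradicts
    that neither dominates the other. *)
Lemma descent_bounded : exists M, forall d l n, descent d l n -> (n < M)%N.
Proof.
have [F FP] := form_values_finite.
have [F1 inF] : exists F1 : seq R, forall b i, small b -> -1 < B b (alpha i) ->
    B b (alpha i) \in F1.
  exists (1 :: F) => b i sb bi; rewrite in_cons.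
  have [->|bni] := eqVneq b (alpha i); first by rewrite form_ii eqxx.
  by rewrite FP ?orbT ?bi ?small_lt1 //; have [[]] := sb.
pose st (b : V) : {ffun I -> option 'I_(size F1).+1} :=
  [ffun i => if B b (alpha i) <= -1 then None
             else Some (inord (index (B b (alpha i)) F1))].
exists #|{: {ffun I -> option 'I_(size F1).+1}}| => d l n D.
rewrite ltnNge; apply/negP => nM; have [sm stp] := D.
have : ~~ injectiveb (fun k : 'I_n.+1 => st (d k)).
  apply/negP => /injectiveP/leq_card; rewrite card_ord => h.
  by move: (leq_trans h nM); rewrite ltnn.
move=> /injectivePn[p' [q' pq' E]].
wlog pq : p' q' pq' E / (p' < q')%N.
  move=> H; have [/(H _ _ pq' E)//|qp|/val_inj pq] := ltngtP p' q'.
    by apply: (H q' p') => //; rewrite eq_sym.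
  by rewrite pq eqxx in pq'.
set p := val p' in pq E *; set q := val q' in pq E *.
have qn : (q <= n)%N by rewrite -ltnS ltn_ord.
have pqn : (p <= q <= n)%N by rewrite ltnW.
have sp := sm p (leq_trans (ltnW pq) qn); have sq := sm q qn.
pose e := d p - d q.
have dpE : d p = d q + e by rewrite /e; vec; ring.
(* i is used between the two roots, so the common record is an exact value *)
have e0 i : co e i != 0 -> B e (alpha i) = 0.
  move=> ei; have [le ex] := descent_diff D pqn i.
  have [|k kpq lk] := ex.
    by rewrite lt_neqAle le andbT; apply: contraNneq ei => h; rewrite /e coD coN h subrr.
  have qi : -1 < B (d q) (alpha i).
    rewrite ltNge; apply/negP => h.
    by have := descent_sticky D pqn h kpq; rewrite lk eqxx.
  have := congr1 (fun u : {ffun I -> option 'I_(size F1).+1} => u i) E.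
  rewrite !ffunE [B (d q) _ <= _]leNgt qi /=; case: ifP => // /negbT; rewrite -ltNge => pi.
  case=> /(congr1 val) /=.
  rewrite !inordK ?ltnS ?index_size // => ix.
  have : B (d p) (alpha i) = B (d q) (alpha i).
    by rewrite -(nth_index 0 (inF _ _ sp pi)) ix nth_index // inF.
  by rewrite /e !formE => ->; rewrite subrr.
have ee : B e e = 0.
  rewrite {1}form_suml big1 // => i _; have [->|ei] := eqVneq (co e i) 0.
    by rewrite mul0r.
  by rewrite formC e0 // mulr0.
have [[rp _] _] := sp; have [[rq _] _] := sq.
clearbody e.
have qe : B (d q) e = 0.
  have := form_root rp; rewrite dpE !formE ee (form_root rq) (formC m e).
  by lra.
have : B (d p) (d q) < 1.
  apply: small_form => //; apply/eqP => pqE.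
  have [k0 l0] : exists2 k, (p <= k < q)%N & co (d q) (l k) < co (d p) (l k).
    have pn : (p < n)%N := leq_trans pq qn.
    exists p; first by rewrite leqnn.
    have [E1 p0] := stp p pn.
    have [|h _] := @descent_diff d l n p.+1 q D _ (l p); first by rewrite pq.
    apply: le_lt_trans h _; rewrite E1 /simple_refl /refl !coE co_bas eqxx mulr1; lra.
  by rewrite pqE ltxx.
by rewrite dpE !formE form_root // (formC m e) qe addr0 ltxx.
Qed.

(** A positive root has a positive form with some simple root, because its form
    with itself is positive. *)
Lemma descent_or_simple n b : small b ->
  (exists w i, (size w <= n)%N /\ b = actw m w (alpha i)) \/
  (exists d l, d 0%N = b /\ descent d l n.+1).
Proof.
elim: n b => [|n IH] b sb.
all: have [[i ->]|bns] := pselect (exists i, b = alpha i); first by left; exists [::], i.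
all: have [i bi] : exists i, 0 < B b (alpha i).
1,3: apply: contrapT => H; have [[rb pb] _] := sb.
1,2: have := form_root rb; rewrite form_suml => /eqP; apply/negP; rewrite lt_eqF //.
1,2: apply: le_lt_trans (ltr01); apply: sumr_le0 => i _.
1,2: rewrite mulr_ge0_le0 ?ngN_ge0 // formC leNgt; apply/negP => h; apply: H; by exists i.
all: have bni : b != alpha i by apply/eqP => h; apply: bns; exists i.
all: have ss := small_desc sb bi bni.
  right; exists (fun k => if k is 0 then b else simple_refl m i b), (fun _ => i).
  by split=> //; split=> [[|[]]|[|]].
have [[w [j [sw E]]]|[d [l [d0 [sm st]]]]] := IH _ ss.
  left; exists (i :: w), j; split=> //=.
  by rewrite -E /simple_refl reflK // form_ii.
right; exists (fun k => if k is k'.+1 then d k' else b).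
exists (fun k => if k is k'.+1 then l k' else i); split=> //; split=> [[|k] //|[|k] //].
  by move=> kn; apply: sm.
by move=> kn; apply: st.
Qed.

Fixpoint words (n : nat) : seq (seq I) :=
  if n is n'.+1 then [::] :: [seq i :: w | i <- enum I, w <- words n'] else [:: [::]].

Lemma mem_words n w : (size w <= n)%N -> w \in words n.
Proof.
elim: n w => [|n IH] [|i w] //= sw; rewrite in_cons /=.
by apply: allpairs_f; rewrite ?mem_enum ?IH.
Qed.

Lemma small_finite : exists s : seq V, forall b, small b -> b \in s.
Proof.
have [M MP] := descent_bounded.
exists [seq actw m w (alpha i) | w <- words M, i <- enum I] => b sb.
have [[w [i [wM ->]]]|[d [l [_ /MP]]]] := descent_or_simple M sb.
  by apply: allpairs_f; rewrite ?mem_enum ?mem_words.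
by rewrite ltnNge leqnSn.
Qed.

(** At most n walls separate the wall of b from 1. *)
Definition nsmall n b := pos_root b /\ forall s : seq V, uniq s ->
  (forall c, c \in s -> [/\ pos_root c, dominates b c & c != b]) -> (size s <= n)%N.

(** Let t dominate u. The reflection in u maps t to b or -b with b a positive root;
    both u and b are separated from 1 by fewer walls than t, and t is recovered
    from them. *)
Lemma nsmall_finite n : exists s : seq V, forall b, nsmall n b -> b \in s.
Proof.
elim: n => [|n [s sP]].
  have [s sP] := small_finite; exists s => b [pb nb]; apply: sP; split=> // c pc bc.
  apply/eqP; apply: contrapT => /negP cb.
  have h c' : c' \in [:: c] -> [/\ pos_root c', dominates b c' & c' != b].
    by rewrite inE => /eqP->.
  by have := nb [:: c] isT h.
have [s0 s0P] := small_finite.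
exists (s0 ++ [seq refl m x y | x <- s, y <- s] ++ [seq - refl m x y | x <- s, y <- s]).
move=> t [pt nt]; rewrite !mem_cat; have [st|nst] := pselect (small t).
  by rewrite s0P.
have [u [pu tu ut]] : exists u, [/\ pos_root u, dominates t u & u != t].
  apply: contrapT => H; apply: nst; split=> // c pc tc.
  by apply/eqP; apply: contrapT => /negP ct; apply: H; exists c.
have [ru ppu] := pu; have [rt ppt] := pt.
have [tu' tuE] := reflection_elt ru.
have rK v : refl m u (refl m u v) = v by rewrite reflK // form_root.
have actr w v : act (w * tu') v = act w (refl m u v) by rewrite actM tuE.
have domN w v : root v -> negative (act w (- v)) = ~~ negative (act w v).
  by move=> rv; rewrite actN ng_opp //; apply: root_act.
have nu : nsmall n u.
  split=> // r ur rP; have := nt (u :: r).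
  rewrite /= ur andbT ltnS; apply.
    by apply/negP => /rP[_ _]; rewrite eqxx.
  move=> c; rewrite in_cons => /orP[/eqP->//|/rP[pc uc cu]]; split=> //.
    exact: dom_trans tu uc.
  apply/eqP => ct; move/eqP: ut; apply; apply: dom_antisym => //; by rewrite -ct.
pose b := refl m u t; have rb : root b by apply: root_refl.
have tE : t = refl m u b by rewrite /b rK.
apply/orP; right; apply/orP; have [nb|ppb] := boolP (negative b).
  right; rewrite tE -[b]opprK; have -> : refl m u (- - b) = - refl m u (- b).
    by rewrite -!scaleN1r !reflZ.
  apply: allpairs_f; first exact: sP.
  have pb' : pos_root (- b) by split; [apply: rootN | rewrite ng_opp // negbK].
  have ub c : dominates (- b) c -> dominates u c.
    move=> bc w wu; apply: bc; rewrite domN //.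
    have : ~~ negative (act (w * tu') u).
      rewrite actr refl_self ?form_root // domN // negbK //.
    rewrite /b -actr; apply: contra; exact: tu.
  have tb : t != - b.
    apply/eqP => tb; move/eqP: ut; apply; apply: dom_antisym => //.
    by apply: ub; rewrite -tb; apply: dom_refl.
  apply: sP; split=> // r ur rP; have := nt (- b :: r).
  rewrite /= ur andbT ltnS; apply.
    by apply/negP => /rP[_ _]; rewrite eqxx.
  have td c : dominates (- b) c -> dominates t c by move=> /ub; apply: dom_trans.
  move=> c; rewrite in_cons => /orP[/eqP->|/rP[pc bc cb]].
    by split=> //; [apply: td; apply: dom_refl | rewrite eq_sym].
  split=> //; first exact: td.
  apply/eqP => ct; move/eqP: ut; apply; apply: dom_antisym => //.
  by rewrite -ct; apply: ub.
left; rewrite tE; apply: allpairs_f; first exact: sP.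
have pb : pos_root b by [].
have nbu : ~ dominates b u.
  move=> bu; have [w wb] : exists w, negative (act w b).
    have [x xE] := reflection_elt rb; exists x.
    by rewrite xE refl_self ?form_root // ng_opp.
  have : negative (act (w * tu') u) by apply: tu; rewrite actr.
  by rewrite actr refl_self ?form_root // domN // (bu _ wb).
(* an injection into the roots other than u and t that are dominated by t *)
pose phi c := if pselect (dominates t c) then c else refl m u c.
have key c : pos_root c -> dominates b c -> ~~ negative (refl m u c) -> dominates t (refl m u c).
  move=> [rc pc] bc pr w wt; rewrite -actr; apply: bc; rewrite actr.
  by rewrite -tE.
have key2 c : pos_root c -> dominates b c -> negative (refl m u c) -> dominates t c.
  move=> [rc pc] bc nr w wt.
  have wu := tu _ wt.
  have wn : negative (act w (refl m u c)) by rewrite -actr; apply: bc; rewrite actr -tE.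
  have rr : root (refl m u c) by apply: root_refl.
  have cE : c = (2 * B c u) *: u + 1 *: refl m u c by rewrite /refl (formC m c); vec; ring.
  have c0 : 0 <= 2 * B c u.
    rewrite mulr_ge0 // leNgt; apply/negP => h.
    have rE : refl m u c = 1 *: c + (- (2 * B c u)) *: u.
      by rewrite /refl (formC m c); vec; ring.
    have h' : 0 <= - (2 * B c u) by lra.
    by rewrite (ng_comb rc ru rr ler01 h' rE (negbTE pc) (negbTE ppu)) in nr.
  have wE : act w c = (2 * B c u) *: act w u + 1 *: act w (refl m u c).
    by rewrite {1}cE actD !actZ.
  by apply: (ng_comb (root_act w ru) (root_act w rr) (root_act w rc) c0 ler01 wE wu wn).
apply: sP; split=> // r ur rP.
have phiP c : c \in r -> [/\ pos_root (phi c), dominates t (phi c), phi c != t & phi c != u].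
  move=> /rP[pc bc cb]; rewrite /phi; case: pselect => tc.
    split=> //.
      by apply/eqP => ct; apply: nbu; apply: dom_trans tu; rewrite -ct.
    by apply/eqP => cu; apply: nbu; rewrite -cu.
  have pr : ~~ negative (refl m u c) by apply/negP => /(key2 c pc bc).
  split.
  - by split=> //; apply: root_refl => //; have [] := pc.
  - exact: key.
  - by apply/eqP => E; move/eqP: cb; apply; rewrite /b -E rK.
  - apply/eqP => E; have [_ /negP] := pc; apply.
    by rewrite -[c]rK E refl_self ?form_root // ng_opp.
have phi_inj : {in r &, injective phi}.
  have AB c c' : c \in r -> c' \in r -> dominates t c -> ~ dominates t c' -> c <> refl m u c'.
    move=> /rP[pc bc _] /rP[[rc' pc'] bc' _] tc ntc' E; apply: ntc'.
    by rewrite -[c']rK -E; apply: key => //; rewrite E rK.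
  move=> c c' cr cr'; rewrite /phi; case: pselect => tc; case: pselect => tc' //.
  - by move=> /(AB _ _ cr cr' tc tc').
  - by move=> /esym/(AB _ _ cr' cr tc' tc).
  - by move=> /(congr1 (refl m u)); rewrite !rK.
have := nt (u :: map phi r); rewrite /= size_map ltnS; apply.
  rewrite map_inj_in_uniq // ur andbT; apply/negP => /mapP[c /phiP[_ _ _]].
  by rewrite eq_sym => /eqP.
by move=> c; rewrite in_cons => /orP[/eqP->//|/mapP[c' /phiP[? ? ? _] ->]].
Qed.

(** * Inversions, cone classes and walls *)

Lemma disjP g h : disj g h <->
  (forall b, pos_root b -> negative (act g^-1 b) -> ~~ negative (act h^-1 b)).
Proof.
have := add_lenP g^-1 h; rewrite (lenV f2 fgen) => H; split.
  by move=> /H H' b [rb pb]; apply: H'.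
by move=> H'; apply/H => b rb pb; apply: H'.
Qed.

Lemma prefixP g h : prefix g h <->
  (forall b, pos_root b -> negative (act g^-1 b) -> negative (act h^-1 b)).
Proof.
have := add_lenP g (g^-1 * h); rewrite mulVKg invgM invgK => H; split.
  move=> /H H' b [rb pb] ngb; set c := - act g^-1 b.
  have rg : root (act g^-1 b) by apply: root_act.
  have pc : ~~ negative c by rewrite ng_opp // ngb.
  have gc : act g c = - b by rewrite actN actVK.
  have rh : root (act h^-1 b) by apply: root_act.
  have ngc : negative (act g c) by rewrite gc ng_opp.
  by have := H' c (rootN rg) pc ngc; rewrite actM gc actN ng_opp // negbK.
move=> H'; apply/H => b rb pb ngb; set c := - act g b.
have rg : root (act g b) by apply: root_act.
have pc : pos_root c by split; [apply: rootN | rewrite ng_opp // ngb].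
have gc : act g^-1 c = - b by rewrite actN actK.
have rh : root (act h^-1 (act g b)) by apply: root_act.
have ngc : negative (act g^-1 c) by rewrite gc ng_opp.
by have := H' c pc ngc; rewrite actN ng_opp // actM.
Qed.

Lemma small_dominated b : pos_root b -> exists2 c, small c & dominates b c.
Proof.
move=> pb; have [rb ppb] := pb.
have [s] : exists s : seq V, forall c, pos_root c -> dominates b c -> c \in s.
  have [t tE] := reflection_elt rb; have [s _ sP] := inv_finite t.
  exists s => c [rc pc] bc; apply: sP => //; apply: bc.
  by rewrite tE refl_self ?form_root // ng_opp.
have [n] := ubnP (size s); elim: n s b pb {rb ppb} => // n IH s b pb sn sP.
have [sb|nsb] := pselect (small b); first by exists b.
have [c [pc bc cb]] : exists c, [/\ pos_root c, dominates b c & c != b].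
  apply: contrapT => H; apply: nsb; split=> // c pc bc.
  by apply/eqP; apply: contrapT => /negP cb; apply: H; exists c.
have bs : b \in s by apply: sP.
have [||d sd cd] := IH (rem b s) c pc.
- by rewrite size_rem //; case: (s) bs sn.
- move=> d pd cd; have ds : d \in s by apply: sP => //; apply: dom_trans cd.
  move: ds; rewrite (perm_mem (perm_to_rem bs)) in_cons => /orP[/eqP db|//].
  case/eqP: cb; apply: dom_antisym => //; by rewrite -db.
by exists d => //; apply: dom_trans cd.
Qed.

(** If N(x) and N(y) meet, they meet in a small root dominated by a common
    element. *)
Lemma cone_eq_small x x' :
  (forall b, small b -> negative (act x^-1 b) = negative (act x'^-1 b)) -> cone_eq x x'.
Proof.
have H y y' z : (forall b, small b -> negative (act y^-1 b) = negative (act y'^-1 b)) ->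
    disj y z -> disj y' z.
  move=> E /disjP yz; apply/disjP => b pb nb; apply/negP => nz.
  have [c sc bc] := small_dominated pb; have [pc _] := sc.
  by have := yz c pc; rewrite E // (bc _ nb) (bc _ nz) => /(_ isT).
by move=> E y; split; apply: H => // b sb; rewrite E.
Qed.

Lemma finite_cone_types : exists (Q : finType) (col : W -> Q),
  forall x x', col x = col x' -> cone_eq x x'.
Proof.
have [s sP] := small_finite.
exists {ffun 'I_(size s) -> bool}.
exists (fun x => [ffun k => negative (act x^-1 (nth 0 s (val k)))]) => x x' E.
apply: cone_eq_small => b /sP bs; have bi : (index b s < size s)%N by rewrite index_mem.
by have := congr1 (fun u : {ffun _ -> bool} => u (Ordinal bi)) E; rewrite !ffunE /= nth_index.
Qed.

Lemma reflection_elt_finite (s : seq V) : exists K, forall b t, b \in s ->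
  (forall v, act t v = refl m b v) -> (len t <= K)%N.
Proof.
elim: s => [|b s [K KP]]; first by exists 0%N.
have [[t tE]|H] := pselect (exists t, forall v, act t v = refl m b v); last first.
  exists K => c t; rewrite in_cons => /orP[/eqP->|cs]; last exact: KP.
  by move=> tE; case: H; exists t.
exists (maxn K (len t)) => c u; rewrite in_cons leq_max => /orP[/eqP->|cs] uE; last first.
  by rewrite (KP c u).
suff -> : u = t by rewrite leqnn orbT.
apply: (mulgI t^-1%g); rewrite mulVg; apply: act_faithful => v.
by rewrite actM uE -tE actK.
Qed.

Lemma act_conj z i v : act (z^-1 * f i * z) v = refl m (act z^-1 (alpha i)) v.
Proof.
rewrite !actM act_f /simple_refl /refl actD actN actZ actK.
by rewrite -(form_act z^-1) actK.
Qed.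

Lemma refl_opp b v : refl m (- b) v = refl m b v.
Proof. by rewrite /refl formNr; vec; ring. Qed.

(** The path labelled by c crosses the wall of [f i] starting from Y^-1, where Y is y
    or [y * f i] and z lies between 1 and Y^-1. A wall that separates z from the
    wall of [f i] separates z from 1, hence it does not separate z from Y^-1, and it
    is crossed by the path labelled by c as well. So there are at most K such
    walls, and seen from z the wall of [f i] is one of finitely many. *)
Lemma near_wall K : exists K2, forall i (y c z : W),
  len (y * f i) = (len y).+1 -> prefix c (y * f i) -> ~ prefix c y ->
  (len c <= K)%N -> prefix z y^-1 \/ prefix z (y * f i)^-1 ->
  (len (z^-1 * f i * z) <= K2)%N.
Proof.
have [s sP] := nsmall_finite K; have [K2 K2P] := reflection_elt_finite s.
exists K2 => i y c z yi cyi ncy cK zy.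
have yp : ~~ negative (act y (alpha i)) by rewrite ng_act yi -leqNgt leqnSn.
have ryi : root (act y (alpha i)) by apply/root_act/root_simple.
have cy : negative (act c^-1 (act y (alpha i))).
  apply: contrapT => ncy'; apply: ncy; apply/prefixP => b pb ncb.
  have /prefixP/(_ b pb ncb) := cyi; rewrite invgM (fV f2) actM act_f => nb.
  apply: contraTT nb => pyb; have [rb _] := pb.
  apply: ng_sg => //; first exact: root_act.
  by apply/eqP => E; apply: ncy'; rewrite -E actVK.
have [Y [zY yY]] : exists Y, prefix z Y^-1 /\
    (act Y (alpha i) = act y (alpha i) \/ act Y (alpha i) = - act y (alpha i)).
  case: zy => zy; first by exists y; split=> //; left.
  by exists (y * f i)%g; split=> //; right; rewrite act_simple_sg.
have [b [pb bE zb]] : exists b, [/\ pos_root b,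
    forall v, refl m (act z^-1 (alpha i)) v = refl m b v &
    act z b = alpha i \/ act z b = - alpha i].
  have rz : root (act z^-1 (alpha i)) by apply/root_act/root_simple.
  have [nz|pz] := boolP (negative (act z^-1 (alpha i))).
    exists (- act z^-1 (alpha i)); split=> [|v|].
    - by split; [apply: rootN | rewrite ng_opp // negbK].
    - by rewrite refl_opp.
    - by right; rewrite actN actVK.
  by exists (act z^-1 (alpha i)); split=> //; left; rewrite actVK.
apply: (K2P b); last by move=> v; rewrite act_conj bE.
apply: sP; split=> // r ur rP.
have [t st tP] := inv_finite c^-1.
rewrite -(lenV f2 fgen) in cK; apply: leq_trans (leq_trans st cK).
have [rb ppb] := pb.
have injm : injective (fun v => act Y (act z v)).
  by apply: (can_inj (g := fun v => act z^-1 (act Y^-1 v))) => v; rewrite actK actK.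
rewrite -(size_map (fun v => act Y (act z v))); apply: uniq_leq_size.
  by rewrite map_inj_uniq.
move=> _ /mapP[d dr ->]; have [[rd pd] bd db] := rP _ dr.
have rzd : root (act z d) by apply: root_act.
have rYd : root (act Y (act z d)) by apply: root_act.
have nzd : negative (act z d).
  have ni : negative (- alpha i) by rewrite ng_opp ?ng_simple //; apply: root_simple.
  have fi : act (f i) (alpha i) = - alpha i by rewrite act_f /simple_refl refl_self // form_ii.
  have [zn|zn] : negative (act z b) \/ negative (act (f i * z) b).
  - by rewrite actM; case: zb => ->; [right; rewrite fi | left].
  - exact: bd.
  - have := bd _ zn; rewrite actM act_f; apply: contraLR => pzd.
    apply: ng_sg => //; apply/eqP => E; case/eqP: db.
    case: zb => zb; first by rewrite -[d](actK z) E -zb actK.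
    have : negative (- act z d) by rewrite E.
    have dE : d = - b by rewrite -[d](actK z) E -[alpha i]opprK -zb actN actK.
    by move: pd; rewrite dE ng_opp // ppb.
have pYd : ~~ negative (act Y (act z d)).
  have pzd : pos_root (- act z d) by split; [apply: rootN | rewrite ng_opp // negbK].
  have /prefixP/(_ _ pzd) := zY; rewrite invgK actN actK ng_opp // pd => /(_ isT).
  by rewrite actN ng_opp.
have pYb : ~~ negative (act Y (act z b)).
  by apply: contra pYd; rewrite -!actM; apply: bd.
have Yb : act Y (act z b) = act y (alpha i).
  have {}pYb : negative (act Y (act z b)) = false by apply/negbTE.
  have nyi : negative (- act y (alpha i)) by rewrite ng_opp.
  case: zb pYb => ->; case: yY; rewrite ?actN => -> //; rewrite ?opprK ?nyi //.
apply: tP => //; rewrite -!actM; apply: bd.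
by rewrite !actM Yb.
Qed.

(** * Residues of rank two *)

Section Residue.
Variables (i j : I).
Hypothesis ij : i != j.

Definition in_plane b := forall k, k != i -> k != j -> co b k = 0.

Lemma in_plane_dec b : in_plane b -> b = co b i *: alpha i + co b j *: alpha j.
Proof.
move=> pb; apply/coP => k; rewrite !coE !co_bas.
have [<-|ki] := eqVneq i k.
  by rewrite (eq_sym j) (negbTE ij) mulr1 mulr0 addr0.
have [<-|kj] := eqVneq j k; first by rewrite mulr0 mulr1 add0r.
by rewrite !mulr0 addr0 pb // eq_sym.
Qed.

Definition dihedral (y : W) := exists2 u, ev u = y & all (fun k => (k == i) || (k == j)) u.

Lemma dih1 : dihedral 1%g.
Proof. by exists [::]; rewrite ?ev_nil. Qed.

Lemma dih_Mf y k : dihedral y -> (k == i) || (k == j) -> dihedral (y * f k)%g.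
Proof.
by move=> [u <- au] kij; exists (rcons u k); rewrite ?ev_rcons // all_rcons kij.
Qed.

Lemma dihV y : dihedral y -> dihedral y^-1%g.
Proof.
by move=> [u <- au]; exists (rev u); [exact: ev_rev f2 u | rewrite all_rev].
Qed.

Lemma dih_co y b k : dihedral y -> k != i -> k != j -> co (act y b) k = co b k.
Proof.
move=> [u <- au] ki kj; rewrite act_ev; elim: u au => //= l u IH /andP[l_ij /IH <-].
by rewrite co_sg //; case/orP: l_ij => /eqP ->.
Qed.

Lemma dih_plane y b : dihedral y -> in_plane b -> in_plane (act y b).
Proof. by move=> dy pb k ki kj; rewrite dih_co // pb. Qed.

Lemma plane_simple k : (k == i) || (k == j) -> in_plane (alpha k).
Proof.
move=> kij l li lj; rewrite co_bas; have [kl|//] := eqVneq k l.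
by move: kij; rewrite kl (negbTE li) (negbTE lj).
Qed.

Lemma pos_plane v b : pos_root (act v (alpha i)) -> pos_root (act v (alpha j)) ->
  pos_root b -> in_plane b -> ~~ negative (act v b).
Proof.
move=> [ri pi] [rj pj] [rb pb] ib.
have bE : act v b = co b i *: act v (alpha i) + co b j *: act v (alpha j).
  by rewrite {1}(in_plane_dec ib) actD !actZ.
apply/negbT; apply: (ng_comb ri rj (root_act v rb) _ _ bE (negbTE pi) (negbTE pj)).
  exact: ngN_ge0.
exact: ngN_ge0.
Qed.

Lemma exists_dih_min x : exists v u, [/\ x = (v * u)%g, dihedral u,
  pos_root (act v (alpha i)) & pos_root (act v (alpha j))].
Proof.
pose P n := `[< exists v u, [/\ x = (v * u)%g, dihedral u & len v = n] >].
have Pex : exists n, P n.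
  by exists (len x); apply/asboolP; exists x, 1%g; rewrite mulg1; split=> //; apply: dih1.
case: (ex_minnP Pex) => n /asboolP[v [u [xE du vn]]] nmin.
exists v, u.
have H k : (k == i) || (k == j) -> pos_root (act v (alpha k)).
  move=> kij; split; first exact/root_act/root_simple.
  rewrite ng_act -leqNgt vn; apply: nmin; apply/asboolP.
  exists (v * f k)%g, (f k * u)%g; split=> //; first by rewrite mulgA cox_genKr.
  have := dihV (dih_Mf (dihV du) kij).
  by rewrite invgM invgK (fV f2).
by split=> //; apply: H; rewrite eqxx ?orbT.
Qed.

Variables (v u : W).
Hypothesis du : dihedral u.
Hypothesis vi : pos_root (act v (alpha i)).
Hypothesis vj : pos_root (act v (alpha j)).

Lemma dih_prefix y : dihedral y -> prefix v (v * y)%g.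
Proof.
move=> dy; apply/prefixP => b [rb pb] nb; rewrite invgM actM.
have rc : root (act v^-1 b) by apply: root_act.
have [[k [ki kj kn]]|H] :=
    pselect (exists k, [/\ k != i, k != j & co (act v^-1 b) k != 0]).
  apply/existsP; exists k; rewrite dih_co //; last exact: dihV.
  by rewrite lt_neqAle kn ng_le0.
have pc : in_plane (- act v^-1 b).
  move=> k ki kj; rewrite coN; apply/eqP; rewrite oppr_eq0.
  by apply: contrapT => /negP kn; apply: H; exists k.
have prc : pos_root (- act v^-1 b) by split; [apply: rootN | rewrite ng_opp // nb].
by have := pos_plane vi vj prc pc; rewrite actN actVK ng_opp // pb.
Qed.

Lemma in_plane_of_inv c : pos_root c -> negative (act u^-1 c) -> in_plane c.
Proof.
move=> [rc pc] nc k ki kj; apply/eqP; rewrite eq_le ngN_ge0 // andbT.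
rewrite -(dih_co c (dihV du) ki kj); by apply: ng_le0 => //; apply: root_act.
Qed.

Hypothesis xi : negative (act (v * u) (alpha i)).
Hypothesis xj : negative (act (v * u) (alpha j)).

Lemma dih_longest_neg k : (k == i) || (k == j) -> negative (act u (alpha k)).
Proof.
move=> kij; have ru : root (act u (alpha k)) by apply/root_act/root_simple.
have : negative (act (v * u) (alpha k)) by case/orP: kij => /eqP->.
apply: contraLR => pu; rewrite actM; apply: pos_plane => //.
by apply: dih_plane => //; apply: plane_simple.
Qed.

(** The chamber opposite to v in its residue is adjacent to the same two walls
    as v. *)
Lemma dih_longest_wall k : (k == i) || (k == j) ->
  exists2 l, (l == i) || (l == j) & act u (alpha l) = - alpha k.
Proof.
move=> kij; pose k' := if k == i then j else i.
have k'k : k' != k.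
  rewrite /k'; have [->|ki] := eqVneq k i; first by rewrite eq_sym.
  by rewrite eq_sym.
have kk' q : (q == i) || (q == j) -> q != k' -> q = k.
  rewrite /k'; case/orP: kij => /eqP ->.
    by rewrite eqxx => /orP[]/eqP-> //; rewrite eqxx.
  by rewrite (eq_sym j) (negbTE ij) => /orP[]/eqP-> //; rewrite eqxx.
set c := act u^-1 (alpha k).
have rc : root c by apply/root_act/root_simple.
have cE : c = co c i *: alpha i + co c j *: alpha j.
  by apply/in_plane_dec/dih_plane; [apply: dihV | apply: plane_simple].
have kE : alpha k = co c i *: act u (alpha i) + co c j *: act u (alpha j).
  by rewrite -[alpha k](actVK u) -/c {1}cE actD !actZ.
have ru l : root (act u (alpha l)) by apply/root_act/root_simple.
have nui : negative (act u (alpha i)) by apply: dih_longest_neg; rewrite eqxx.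
have nuj : negative (act u (alpha j)) by apply: dih_longest_neg; rewrite eqxx orbT.
have nc : negative c.
  apply: contraT => pc.
  have := ng_comb (ru i) (ru j) (root_simple k) (ngN_ge0 pc i) (ngN_ge0 pc j) kE nui nuj.
  by rewrite ng_simple.
have T l : negative (act u (alpha l)) -> 0 <= co c l * co (act u (alpha l)) k'.
  by move=> nl; rewrite mulr_le0 // ?(ng_le0 rc nc) // (ng_le0 (ru l) nl).
have T0 : co c i * co (act u (alpha i)) k' + co c j * co (act u (alpha j)) k' = 0.
  by have := congr1 (fun v => co v k') kE; rewrite !coE co_bas eq_sym (negbTE k'k) => <-.
have fin l : (l == i) || (l == j) -> co c l != 0 -> act u (alpha l) = - alpha k.
  move=> lij cl; have nul : negative (act u (alpha l)) by apply: dih_longest_neg.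
  have ul0 : co (act u (alpha l)) k' = 0.
    have Ti := T i nui; have Tj := T j nuj.
    suff : co c l * co (act u (alpha l)) k' = 0.
      by move/eqP; rewrite mulf_eq0 (negbTE cl) => /eqP.
    by case/orP: lij => /eqP->; lra.
  rewrite -[LHS]opprK; congr (- _); apply: pos_root_simple.
  - exact: rootN.
  - by rewrite ng_opp // nul.
  move=> q qk; rewrite coN; apply/eqP; rewrite oppr_eq0; apply/eqP.
  have [->//|qk'] := eqVneq q k'.
  apply: (dih_plane du (plane_simple lij)).
    by apply: contra qk => /eqP qi; rewrite [q]kk' ?qi ?eqxx // -qi.
  by apply: contra qk => /eqP qj; rewrite [q]kk' ?qj ?eqxx ?orbT // -qj.
have [ci|ci] := eqVneq (co c i) 0; last first.
  by exists i; rewrite ?eqxx // fin ?eqxx.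
have [cj|cj] := eqVneq (co c j) 0; last first.
  by exists j; rewrite ?eqxx ?orbT // fin ?eqxx ?orbT.
by have := root_neq0 rc; rewrite cE ci cj !scale0r addr0 eqxx.
Qed.

Let x := (v * u)%g.

(** Suppose that y is disjoint from v but not from x = v * u. The first wall of the
    residue met on the way from 1 to y is one of the two walls adjacent to v,
    hence adjacent to x. Stop right after crossing it: the point reached is
    disjoint from the neighbour of x across that wall but not from x, although
    the neighbour is in the class of x. *)
Lemma residue_cone_eq : cone_eq (x * f i) x -> cone_eq (x * f j) x -> cone_eq v x.
Proof.
move=> Hi Hj; have H k : (k == i) || (k == j) -> cone_eq (x * f k) x.
  by case/orP => /eqP->.
have ra k : root (act v (alpha k)) by apply/root_act/root_simple.
have pa k : (k == i) || (k == j) -> pos_root (act v (alpha k)).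
  by case/orP => /eqP->.
move=> y; split=> [vy|]; last exact: (disj_prefix f2 fgen (dih_prefix du)).
apply/disjP => b pb nb; apply/negP => ny.
have vyP := (disjP v y).1 vy.
(* the first point of a geodesic to y beyond a wall of the residue *)
pose P n := `[< exists y' k, [/\ prefix y' y, len y' = n, (k == i) || (k == j)
   & negative (act y'^-1 (act v (alpha k)))] >].
have plane_pos (z : W) d : pos_root d -> ~~ negative (act v^-1 d) -> in_plane (act v^-1 d) ->
    (forall k, (k == i) || (k == j) -> ~~ negative (act z^-1 (act v (alpha k)))) ->
    ~~ negative (act z^-1 d).
  move=> [rd pd] nd id zk; have zp k : (k == i) || (k == j) -> pos_root (act (z^-1 * v) (alpha k)).
    by move=> kij; split; [apply/root_act/root_simple | rewrite actM zk].
  have pvd : pos_root (act v^-1 d) by split=> //; apply: root_act.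
  have := @pos_plane (z^-1 * v)%g _ (zp i _) (zp j _) pvd id.
  by rewrite actM actVK !eqxx orbT; apply.
have Pex : exists n, P n.
  apply: contrapT => nP; have [rb ppb] := pb.
  have nvb : ~~ negative (act v^-1 b) by apply/negP => h; have := vyP b pb h; rewrite ny.
  suff : ~~ negative (act y^-1 b) by rewrite ny.
  apply: plane_pos => //.
    apply: in_plane_of_inv; first by split=> //; apply: root_act.
    by rewrite -actM -invgM.
  move=> k kij; apply/negP => nk; apply: nP; exists (len y); apply/asboolP.
  by exists y, k; split=> //; apply: prefix_refl.
case: (ex_minnP Pex) => n /asboolP[y' [k [y'y y'n kij nk]]] nmin.
set e := act v (alpha k) in nk; have [re pe] := pa k kij.
have y'1 : y' != 1%g by apply: contraNneq pe => y'1; rewrite y'1 invg1 act1 in nk.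
have [r hr] := right_descent f2 fgen y'1.
set y2 := (y' * f r)%g in hr.
have y2y : prefix y2 y by apply: (prefix_trans fgen (prefix_Mf f2 fgen hr) y'y).
have y'E d : act y'^-1 d = simple_refl m r (act y2^-1 d).
  by rewrite -act_f -actM /y2 invgM (fV f2) cox_genK.
have y2k l : (l == i) || (l == j) -> ~~ negative (act y2^-1 (act v (alpha l))).
  move=> lij; apply/negP => nl; have := nmin (len y2).
  have -> : P (len y2) by apply/asboolP; exists y2, l.
  by move=> /(_ isT); rewrite -y'n -hr ltnn.
have U d : root d -> ~~ negative (act y2^-1 d) -> negative (act y'^-1 d) -> act y2^-1 d = alpha r.
  move=> rd pd; rewrite y'E; apply: contraTeq => h; apply: ng_sg => //.
  exact: root_act.
have ye : act y2^-1 e = alpha r by apply: U => //; apply: y2k.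
have [l lij ul] := dih_longest_wall kij.
have xl : act x (alpha l) = - e by rewrite /x actM ul actN.
have xe : act x^-1 e = - alpha l by rewrite -[e]opprK -xl actN actK.
have nal : negative (- alpha l) by rewrite ng_opp ?ng_simple //; apply: root_simple.
have : disj (x * f l) y'.
  apply/disjP => d [rd pd]; rewrite invgM (fV f2) actM act_f => nd.
  apply/negP => ny'd; have pvd : ~~ negative (act v^-1 d).
    apply/negP => h; have /negP := vyP d (conj rd pd) h; apply.
    by move/prefixP: y'y; apply.
  have rxd : root (act x^-1 d) by apply: root_act.
  have nxd : negative (act x^-1 d).
    apply: contraT => pxd; move: nd; apply: contraLR => _; apply: ng_sg => //.
    apply/eqP => E; move: pd; rewrite -[d](actVK x) E xl ng_opp //.
    by rewrite pe.
  have ipd : in_plane (act v^-1 d).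
    apply: in_plane_of_inv; first by split=> //; apply: root_act.
    by rewrite -actM -invgM.
  have y2d := plane_pos y2 d (conj rd pd) pvd ipd y2k.
  have de : d = e by rewrite -[d](actVK y2) (U d rd y2d ny'd) -ye actVK.
  move: nd; rewrite de xe -scaleN1r /simple_refl reflZ refl_self ?form_ii // scaleN1r opprK.
  by rewrite ng_simple.
move/(H l lij y').1 => /disjP/(_ e (pa k kij)); rewrite xe nal => /(_ isT).
by rewrite nk.
Qed.

End Residue.

Lemma cone_confluence x i j : i != j -> (len (x * f i)).+1 = len x ->
  (len (x * f j)).+1 = len x -> cone_eq (x * f i) x -> cone_eq (x * f j) x ->
  exists v, [/\ prefix v (x * f i), prefix v (x * f j) & cone_eq v x].
Proof.
move=> ij xi xj ei ej; have [v [u [xE du vi vj]]] := exists_dih_min i j x.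
exists v.
have pf k : (k == i) || (k == j) -> prefix v (x * f k).
  move=> kij; rewrite xE -mulgA; apply: (dih_prefix ij vi vj).
  exact: dih_Mf.
split; [by apply: pf; rewrite eqxx | by apply: pf; rewrite eqxx orbT |].
rewrite xE; apply: (residue_cone_eq ij du vi vj); rewrite -?xE //.
  by rewrite ng_act -xi ltnSn.
by rewrite ng_act -xj ltnSn.
Qed.

Lemma disjC x y : disj x y -> disj y x.
Proof. by rewrite /inv_disjoint => xy; rewrite (len_sym f2 fgen) xy addnC. Qed.

Lemma gen_inj : injective f.
Proof.
move=> i j E; have : negative (act (f j) (alpha i)).
  by rewrite -E act_f /simple_refl refl_self ?form_ii // (ng_opp (root_simple i)) ng_simple.
rewrite act_f; have [a_ij _|h] := eqVneq (alpha i) (alpha j).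
  apply/eqP; have := congr1 (fun b => co b i) a_ij.
  rewrite !co_bas eqxx eq_sym; case: eqP => // _ /eqP.
  by rewrite oner_eq0.
have pi : ~~ negative (alpha i) by rewrite ng_simple.
by move=> n; have := ng_sg (root_simple i) pi h; rewrite n.
Qed.

(** Cone classes are convex: [x * f i] is the first point after x on a geodesic to
    x'. On a minimal y not disjoint from x and x', the last wall crossed belongs to
    both N(x) and N(x'), hence to N(z) for every z between x and x'. *)
Lemma cone_eq_geodesic x x' i : cone_eq x x' ->
  (len (x'^-1 * x * f i)).+1 = len (x'^-1 * x) -> cone_eq (x * f i) x.
Proof.
move=> xx' xi; have nx' : negative (act x'^-1 (act x (alpha i))).
  by rewrite -actM ng_act -xi ltnSn.
have xiE b : act (x * f i)^-1 b = simple_refl m i (act x^-1 b).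
  by rewrite invgM (fV f2) actM act_f.
move=> y; split=> xy; last first.
  apply/disjP => b [rb pb]; rewrite xiE => nb; apply/negP => ny.
  have pxb : ~~ negative (act x^-1 b).
    by apply/negP => h; have := (disjP x y).1 xy b (conj rb pb) h; rewrite ny.
  have xb : act x^-1 b = alpha i.
    apply/eqP; apply: contraLR nb => h; apply: ng_sg => //; exact: root_act.
  have := (disjP x' y).1 ((xx' y).1 xy) b (conj rb pb).
  by rewrite ny -[b](actVK x) xb nx' => /(_ isT).
apply: contrapT => nxy.
pose P n := `[< exists y', [/\ prefix y' y, len y' = n & ~ disj x y'] >].
have Pex : exists n, P n.
  by exists (len y); apply/asboolP; exists y; split=> //; apply: prefix_refl.
case: (ex_minnP Pex) => n /asboolP[y' [y'y y'n nxy']] nmin.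
have y'1 : y' != 1%g.
  by apply/eqP => y'1; apply: nxy'; rewrite y'1 /inv_disjoint mulg1 (lenV f2 fgen) len1 addn0.
have [r hr] := right_descent f2 fgen y'1.
set y2 := (y' * f r)%g in hr.
have y2y' : prefix y2 y' := prefix_Mf f2 fgen hr.
have xy2 : disj x y2.
  apply: contrapT => h; have := nmin (len y2).
  have -> : P (len y2).
    by apply/asboolP; exists y2; split=> //; apply: (prefix_trans fgen y2y').
  by move=> /(_ isT); rewrite -y'n -hr ltnn.
have y'E d : act y'^-1 d = simple_refl m r (act y2^-1 d).
  by rewrite -act_f -actM /y2 invgM (fV f2) cox_genK.
have last z : disj z y2 -> ~ disj z y' ->
    pos_root (act y2 (alpha r)) /\ negative (act z^-1 (act y2 (alpha r))).
  move=> zy2 nzy'; have [b [pb nz ny]] : exists b,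
      [/\ pos_root b, negative (act z^-1 b) & negative (act y'^-1 b)].
    apply: contrapT => H; apply: nzy'; apply/disjP => b pb nb.
    by apply/negP => ny; apply: H; exists b.
  suff <- : b = act y2 (alpha r) by [].
  have py2 := (disjP z y2).1 zy2 b pb nz; have [rb ppb] := pb.
  rewrite -[LHS](actVK y2); congr (act _ _); apply/eqP; apply: contraLR ny => h.
  by rewrite y'E; apply: ng_sg => //; apply: root_act.
set b := act y2 (alpha r) in last.
have [pb nxb] := last x xy2 nxy'.
have nx'y' : ~ disj x' y' by move/xx'.
have [_ nx'b] := last x' ((xx' _).1 xy2) nx'y'.
have [rb ppb] := pb.
have nxib : negative (act (x * f i)^-1 b).
  rewrite xiE; apply: contraT => h; exfalso; move: nx'b.
  have rxb : root (act x^-1 b) by apply: root_act.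
  have E : - act x^-1 b = alpha i.
    have pN : ~~ negative (- act x^-1 b) by rewrite ng_opp // negbK.
    apply/eqP; apply: contraLR h => h; have := ng_sg (rootN rxb) pN h.
    rewrite -scaleN1r /simple_refl reflZ scaleN1r ng_opp //.
    by rewrite -/(simple_refl m i _) -act_f; apply: root_act.
  have -> : b = - act x (alpha i) by rewrite -E actN actVK opprK.
  rewrite actN ng_opp ?nx' //; exact/root_act/root_act/root_simple.
have := (disjP (x * f i) y').1 (disjC (disj_prefix f2 fgen y'y (disjC xy))) b pb nxib.
apply/negP; rewrite negbK y'E /b actK /simple_refl refl_self ?form_ii //.
by rewrite (ng_opp (root_simple r)) ng_simple.
Qed.
End Coxeter.

Local Close Scope ring_scope.
Local Open Scope group_scope.

(** * Regular languages *)

Section Regular.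
Variables (A Q : finType) (L : seq A -> Prop) (st : seq A -> Q).

Lemma regular_congruence :
  (forall v v' a, st v = st v' -> st (rcons v a) = st (rcons v' a)) ->
  (forall v v', st v = st v' -> L v -> L v') -> regular L.
Proof.
move=> stS stL.
pose step q a := if pselect (exists v, st v = q) is left e
                 then st (rcons (sval (cid e)) a) else q.
pose M := @Dfa A Q (st [::]) step [set q | `[< exists2 v, st v = q & L v >]].
exists M => w; have runE : foldl step (st [::]) w = st w.
  elim/last_ind: w => // w a IH; rewrite foldl_rcons IH /step.
  case: pselect => [e|ne]; last by case: ne; exists w.
  by apply: stS; case: cid.
rewrite /dfa_accept /= runE inE; split=> [Lw|/asboolP[v vw Lv]].
  by apply/asboolP; exists w.
exact: stL vw Lv.
Qed.
End Regular.

Lemma regular_map (A B : finType) (r : B -> A) (L : seq A -> Prop) :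
  regular L -> regular (fun v => L (map r v)).
Proof.
move=> [M MP]; exists (@Dfa B (dfa_state M) (dfa_init M)
  (fun q b => dfa_step q (r b)) (dfa_final M)) => w.
by rewrite MP /dfa_accept /=; elim: w (dfa_init M) => //= b w IH q.
Qed.

(** * Gates *)

(** From here on the roots intervene only through the hypotheses below, which are
    about lengths and cone classes. *)
Section Gates.
Variables (W : groupType) (I : finType) (f : I -> W).
Local Notation ev := (gen_prod f).
Local Notation len := (gen_len f).
Local Notation prefix := (weak_le f).
Local Notation disj := (inv_disjoint f).
Local Notation cone_eq := (same_cone f).

Hypothesis f2 : forall i, f i * f i = 1.
Hypothesis fgen : forall g : W, exists w, ev w = g.
Hypothesis f_inj : injective f.
Hypothesis len_Mf_cases : forall g i,
  len (g * f i) = (len g).+1 \/ (len (g * f i)).+1 = len g.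
Hypothesis cone_eq_geodesic : forall x x' i, cone_eq x x' ->
  (len (x'^-1 * x * f i)).+1 = len (x'^-1 * x) -> cone_eq (x * f i) x.
Hypothesis cone_confluence : forall x i j, i != j ->
  (len (x * f i)).+1 = len x -> (len (x * f j)).+1 = len x ->
  cone_eq (x * f i) x -> cone_eq (x * f j) x ->
  exists v, [/\ prefix v (x * f i), prefix v (x * f j) & cone_eq v x].
Hypothesis finite_cone_types : exists (Q : finType) (col : W -> Q),
  forall x x', col x = col x' -> cone_eq x x'.
Hypothesis near_wall : forall K, exists K2, forall i (y c z : W),
  len (y * f i) = (len y).+1 -> prefix c (y * f i) -> ~ prefix c y ->
  len c <= K -> prefix z y^-1 \/ prefix z (y * f i)^-1 ->
  len (z^-1 * f i * z) <= K2.

Lemma cone_eq_sym x y : cone_eq x y -> cone_eq y x.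
Proof. by move=> xy z; split=> /xy. Qed.
Lemma cone_eq_trans y x z : cone_eq x y -> cone_eq y z -> cone_eq x z.
Proof. by move=> xy yz t; split=> [/xy/yz//|/yz/xy]. Qed.

Definition is_gate u x := [/\ prefix u x, cone_eq u x &
  forall z, prefix z x -> cone_eq z x -> prefix u z].

Lemma is_gate_below u x z : is_gate u x -> prefix z x -> cone_eq z x -> is_gate u z.
Proof.
move=> [ux uxe umin] zx zxe; split; first exact: umin.
  exact: cone_eq_trans uxe (cone_eq_sym zxe).
move=> t tz tze; apply: umin; first exact: (prefix_trans fgen tz).
exact: cone_eq_trans tze zxe.
Qed.

Lemma is_gate_uniq u u' x : is_gate u x -> is_gate u' x -> u = u'.
Proof.
move=> [ux uxe umin] [ux' uxe' umin'].
by apply: (prefix_antisym fgen); [apply: umin | apply: umin'].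
Qed.

(** By induction on the length of x. Two lower bounds found through different
    descents of x inside the class agree, because by confluence both are gates of
    a common lower element of the class. *)
Lemma gate_exists x : exists u, is_gate u x.
Proof.
have [n] := ubnP (len x); elim: n x => // n IH x xn.
have [[z [zx zxe z_x]]|H] :=
    pselect (exists z, [/\ prefix z x, cone_eq z x & z != x]); last first.
  exists x; split=> //; first exact: prefix_refl.
  move=> z zx zxe; have [->|z_x] := eqVneq z x; first exact: prefix_refl.
  by case: H; exists z.
have down t : prefix t x -> cone_eq t x -> t != x ->
    exists i, [/\ (len (x * f i)).+1 = len x, prefix t (x * f i) & cone_eq (x * f i) x].
  move=> tx txe t_x; have [i [hi ti]] := prefix_descent f2 fgen tx t_x.
  by exists i; split=> //; apply: (cone_eq_convex f2 fgen ti) => //; apply: prefix_Mf.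
have [i [hi zi ei]] := down z zx zxe z_x.
have [|u gu] := IH (x * f i); first by lia.
exists u; have [ui uie umin] := gu; split.
- exact: (prefix_trans fgen ui (prefix_Mf f2 fgen hi)).
- exact: cone_eq_trans uie ei.
move=> t tx txe; have [->|t_x] := eqVneq t x.
  exact: (prefix_trans fgen ui (prefix_Mf f2 fgen hi)).
have [j [hj tj ej]] := down t tx txe t_x.
have [ij|ij] := eqVneq i j.
  by apply: umin; rewrite ij //; apply: cone_eq_trans txe (cone_eq_sym ej).
have [v [vi vj ve]] := cone_confluence ij hi hj ei ej.
have [|u' gu'] := IH (x * f j); first by lia.
have -> : u = u'.
  apply: (@is_gate_uniq _ _ v); apply: is_gate_below; eauto.
    exact: cone_eq_trans ve (cone_eq_sym ei).
  exact: cone_eq_trans ve (cone_eq_sym ej).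
by have [_ _] := gu'; apply=> //; apply: cone_eq_trans txe (cone_eq_sym ej).
Qed.

Definition gate x := sval (cid (gate_exists x)).

Lemma gateP x : is_gate (gate x) x. Proof. by rewrite /gate; case: cid. Qed.
Lemma gate_prefix x : prefix (gate x) x. Proof. by case: (gateP x). Qed.
Lemma gate_cone x : cone_eq (gate x) x. Proof. by case: (gateP x). Qed.

Lemma gate_below z x : prefix z x -> cone_eq z x -> gate z = gate x.
Proof.
by move=> zx ze; apply: is_gate_uniq (gateP z) _; apply: is_gate_below (gateP x) _ _.
Qed.

(** Walk from x to x' inside the class: adjacent elements are comparable, so they
    have the same gate. *)
Lemma gate_class x x' : cone_eq x x' -> gate x = gate x'.
Proof.
have [n] := ubnP (len (x'^-1 * x)); elim: n x => // n IH x xn xx'.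
have [/eqP|x1] := eqVneq (x'^-1 * x) 1; first by rewrite mulg_eq1 => /eqP/invg_inj ->.
have [i hi] := right_descent f2 fgen x1; have e := cone_eq_geodesic xx' hi.
rewrite -(IH (x * f i)); first 1 last.
- by rewrite mulgA -ltnS hi.
- exact: cone_eq_trans e xx'.
have [up|dn] := len_Mf_cases x i.
  apply: gate_below; last exact: cone_eq_sym.
  rewrite -{1}[x](genKr f2 x i); apply: prefix_Mf => //.
  by rewrite genKr // up.
by apply/esym/gate_below; first exact: prefix_Mf.
Qed.

Lemma gate_bounded : exists K, forall x, len (gate x) <= K.
Proof.
have [Q [col colP]] := finite_cone_types.
pose h (q : Q) := if pselect (exists x, col x = q) is left e
                  then len (gate (sval (cid e))) else 0.
exists (\max_(q : Q) h q) => x; apply: leq_trans (leq_bigmax (col x)).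
rewrite /h; case: pselect => [e|ne]; last by case: ne; exists x.
by case: cid => x' /= /colP/gate_class ->.
Qed.

(** * The voracious projection *)

Lemma len_f1 i : len (f i) = 1%N.
Proof. by have := len_Mf_cases 1 i; rewrite mul1g len1; lia. Qed.

Lemma len_fM_cases g i :
  len (f i * g) = (len g).+1 \/ (len (f i * g)).+1 = len g.
Proof.
by have := len_Mf_cases g^-1 i; rewrite -(lenV f2 fgen (_ * f i)) invgM invgK (fV f2) (lenV f2 fgen).
Qed.

Lemma disj_f x i : disj x (f i) <-> len (f i * x) = (len x).+1.
Proof.
rewrite /disj len_f1 addn1 -(lenV f2 fgen (_ * f i)) invgM invgK (fV f2).
by [].
Qed.

Lemma disj_fM x y i : len (f i * x) = (len x).+1 ->
  disj (f i * x) y <-> len (f i * y) = (len y).+1 /\ disj x (f i * y).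
Proof.
rewrite /disj invgM (fV f2) -mulgA => ->.
have := lenM fgen x^-1 (f i * y); rewrite (lenV f2 fgen).
have := len_fM fgen i y.
by move: (len (x^-1 * (f i * y))) (len (f i * y)) (len x) (len y) => *; lia.
Qed.

Lemma cone_eq_up x x' i : cone_eq x x' -> len (f i * x) = (len x).+1 ->
  len (f i * x') = (len x').+1.
Proof. by move=> xx' /disj_f/xx'/disj_f. Qed.

Lemma cone_eq_fM x x' i : cone_eq x x' -> len (f i * x) = (len x).+1 ->
  cone_eq (f i * x) (f i * x').
Proof.
move=> xx' up y; have up' := cone_eq_up xx' up.
split; first by move/(disj_fM y up) => [h1 /xx' h2]; apply/(disj_fM y up').
by move/(disj_fM y up') => [h1 /xx' h2]; apply/(disj_fM y up).
Qed.

Definition proj g := g * gate g^-1.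

Lemma prefix_flip a b g : prefix a b -> prefix b g^-1 -> prefix (g * b) (g * a).
Proof.
move=> ab bg; have ag := prefix_trans fgen ab bg; move: ab bg ag.
rewrite /prefix (lenV f2 fgen) -!(lenV f2 fgen (_ * g^-1)) !invgM !invgK => ab bg ag.
have -> : b^-1 * g^-1 * (g * a) = b^-1 * a by rewrite mulgA mulgVK.
by rewrite (len_sym f2 fgen b a); move: ab bg ag; move: (len _) (len _) (len _) (len _) (len _) (len _) => *; lia.
Qed.

Lemma len_proj g : len g = len (proj g) + len (gate g^-1).
Proof.
have := gate_prefix g^-1; rewrite /prefix (lenV f2 fgen).
rewrite -(lenV f2 fgen (_ * g^-1)) invgM !invgK addnC; exact.
Qed.

Lemma proj_prefix g : prefix (proj g) g.
Proof.
rewrite /prefix {1}len_proj /proj invgM -mulgA mulVg mulg1.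
by rewrite (lenV f2 fgen).
Qed.

(** [f i] is not disjoint from g^-1, hence not from its gate: it lies below it. *)
Lemma proj_descent g i : (len (g * f i)).+1 = len g -> prefix (proj g) (g * f i).
Proof.
move=> dn; apply: prefix_flip; last exact: gate_prefix.
set G := gate g^-1; have : ~ disj G (f i).
  move/(gate_cone g^-1)/disj_f; rewrite -(lenV f2 fgen (f i * _)) invgM invgK (fV f2).
  by rewrite (lenV f2 fgen) -dn; move: (len (g * f i)) => a; lia.
rewrite /prefix (fV f2) len_f1; have [up|<-] := len_fM_cases G i; last by rewrite add1n.
by move/disj_f: up => up /(_ up).
Qed.

(** [f i * gate h^-1] lies below [f i * h^-1] in the same class, hence above the
    gate of the latter. *)
Lemma proj_mono_step h i : len (h * f i) = (len h).+1 -> prefix (proj h) (proj (h * f i)).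
Proof.
move=> up; set x := h^-1; have gx : (h * f i)^-1 = f i * x by rewrite invgM (fV f2).
have upx : len (f i * x) = (len x).+1.
  by rewrite -gx (lenV f2 fgen) up (lenV f2 fgen).
set A := f i * gate x.
have upG := cone_eq_up (cone_eq_sym (gate_cone x)) upx.
have Ax : prefix A (f i * x).
  have := gate_prefix x; rewrite /prefix upx upG invgM (fV f2) -mulgA (genK f2).
  by move=> ->; rewrite addSn.
have GA : prefix (gate (f i * x)) A.
  have [_ _] := gateP (f i * x); apply=> //.
  apply: cone_eq_fM => //; exact: gate_cone.
have -> : proj h = h * f i * A by rewrite /A -mulgA (genK f2).
by rewrite /proj gx; apply: prefix_flip => //; rewrite gx.
Qed.

Lemma proj_mono h g : prefix h g -> prefix (proj h) (proj g).
Proof.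
have [n] := ubnP (len (h^-1 * g)); elim: n g => // n IH g gn hg.
have [/eqP|g1] := eqVneq (h^-1 * g) 1.
  by rewrite mulg_eq1 => /eqP/invg_inj <-; apply: prefix_refl.
have hg' : h != g by apply: contra g1 => /eqP ->; rewrite mulVg.
have [i [gi hi]] := prefix_descent f2 fgen hg hg'.
apply: (prefix_trans fgen (v := proj (g * f i))).
  apply: IH => //; move: hg hi; rewrite /prefix; lia.
rewrite -{2}[g](genKr f2 g i); apply: proj_mono_step.
by rewrite genKr // gi.
Qed.

Definition projn k g := iter k proj g.

Lemma projnS k g : projn k.+1 g = proj (projn k g). Proof. by []. Qed.
Lemma projnSr k g : projn k.+1 g = projn k (proj g). Proof. exact: iterSr. Qed.
Lemma projnD k l g : projn (k + l) g = projn k (projn l g). Proof. exact: iterD. Qed.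

Lemma projn_prefix k g : prefix (projn k g) g.
Proof.
elim: k => [|k IH]; first exact: prefix_refl.
exact: (prefix_trans fgen (proj_prefix _) IH).
Qed.

Lemma projn_mono k h g : prefix h g -> prefix (projn k h) (projn k g).
Proof. by move=> hg; elim: k => //= k IH; apply: proj_mono. Qed.

Section Fellow.
Variables (K : nat) (KP : forall x, len (gate x) <= K).

(** Going down along i, [projn k (g * f i)] lies between [projn k.+1 g] and
    [projn k g]. *)
Lemma projn_step k g i : len ((projn k g)^-1 * projn k (g * f i)) <= K.
Proof.
have H h : (len (h * f i)).+1 = len h ->
    len ((projn k h)^-1 * projn k (h * f i)) <= K.
  move=> dn.
  have h1 : prefix (projn k.+1 h) (projn k (h * f i)).
    by rewrite projnSr; apply: projn_mono; apply: proj_descent.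
  have h2 : prefix (projn k (h * f i)) (projn k h).
    by apply: projn_mono; apply: prefix_Mf.
  have := len_proj (projn k h); have := KP (projn k h)^-1; rewrite -projnS.
  have := prefix_len h1; rewrite (len_sym f2 fgen).
  by move: h2; rewrite /prefix; lia.
have [up|] := len_Mf_cases g i; last exact: H.
rewrite (len_sym f2 fgen) -{2}[g](genKr f2 g i); apply: H.
by rewrite genKr // up.
Qed.

Lemma projn_lipschitz k g h :
  len ((projn k g)^-1 * projn k h) <= K * len (g^-1 * h).
Proof.
have [w wE <-] := len_wit fgen (g^-1 * h).
have -> : h = g * ev w by rewrite wE mulVKg.
elim: w g {h wE} => [|i w IH] g; first by rewrite ev_nil mulg1 mulVg len1 muln0.
apply: leq_trans (len_triV fgen _ _ (projn k (g * f i))) _.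
rewrite [size _]/= mulnS leq_add ?projn_step //.
by rewrite ev_cons mulgA.
Qed.

(** Let x be the last common iterate of the projections based at 1 and at [f i].
    The cone classes of x^-1 and x^-1 * f i differ, so one of the two gates
    crosses the wall of [f i], which is therefore close to x. *)
Lemma projn_left : exists K', forall k g i,
  len ((projn k g)^-1 * f i * projn k (f i * g)) <= K'.
Proof.
have [K2 K2P] := near_wall K; exists (K2 + K * K2) => k g i.
pose P j := projn j g != f i * projn j (f i * g).
have [Pk|/negPn/eqP ->] := boolP (P k); last first.
  by rewrite invgM (fV f2) (genKr f2) mulVg len1.
have exP : exists j, P j by exists k.
case: (ex_minnP exP) => -[|j] Pj jmin.
  by move: Pj; rewrite /P /= genK // eqxx.
have jk : j < k by apply: jmin.
have xB : projn j g = f i * projn j (f i * g).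
  by apply/eqP; apply: contraT => h; have := jmin j h; rewrite ltnn.
set x := projn j g in xB *.
have Bx : projn j (f i * g) = f i * x by rewrite xB genK.
have ngate : gate x^-1 != gate (x^-1 * f i).
  apply: contra Pj => /eqP E.
  by rewrite !projnS -/x Bx /proj invgM (fV f2) -E -mulgA genK.
have ncone y : gate (y * f i) != gate y -> len (y * f i) = (len y).+1 ->
    ~ prefix (gate (y * f i)) y.
  move=> negative up cy; case/eqP: negative; apply/esym/gate_class.
  apply: (cone_eq_convex f2 fgen cy _ (gate_cone _)).
  rewrite -{1}[y](genKr f2 y i); apply: prefix_Mf => //.
  by rewrite genKr.
have near z : prefix z x -> len (z^-1 * f i * z) <= K2.
  move=> zx; have [up|dn] := len_Mf_cases x^-1 i.
    apply: (K2P i x^-1 (gate (x^-1 * f i))) => //; first exact: gate_prefix.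
      by apply: ncone; rewrite // eq_sym.
    by left; rewrite invgK.
  have yx : x^-1 * f i * f i = x^-1 by rewrite genKr.
  apply: (K2P i (x^-1 * f i) (gate x^-1)); rewrite ?yx //; first exact: gate_prefix.
    by have := ncone (x^-1 * f i); rewrite yx; apply.
  by right; rewrite invgK.
have kE : k = (k - j) + j by rewrite subnK // ltnW.
set t := k - j in kE.
rewrite {2}kE projnD Bx.
have zE : projn k g = projn t x by rewrite kE projnD.
have zx : prefix (projn k g) x by rewrite zE; apply: projn_prefix.
have := len_triV fgen (projn k g) (f i * projn t (f i * x)) (f i * projn k g).
rewrite invgM (fV f2) -!mulgA (genK f2) => tri.
apply: leq_trans tri _; apply: leq_add; first by rewrite mulgA near.
rewrite zE; apply: leq_trans (projn_lipschitz _ _ _) _.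
by rewrite leq_mul2l mulgA near ?orbT //; apply: prefix_refl.
Qed.

(** * The voracious language *)

Inductive voracious : seq I -> Prop :=
| voracious_nil : voracious [::]
| voracious_cat v w : voracious v -> w != [::] ->
    ev w = (gate (ev (v ++ w))^-1)^-1 -> size w = len (ev w) -> voracious (v ++ w).

Lemma proj_voracious v w :
  ev w = (gate (ev (v ++ w))^-1)^-1 -> proj (ev (v ++ w)) = ev v.
Proof. by move=> wE; rewrite /proj -[gate _]invgK -wE ev_cat mulgK. Qed.

Lemma voracious_geodesic v : voracious v -> size v = len (ev v).
Proof.
elim=> [|{}v w _ IH _ wE sw]; first by rewrite ev_nil len1.
rewrite size_cat IH sw [RHS]len_proj (proj_voracious wE) {1}wE.
by rewrite (lenV f2 fgen).
Qed.

Lemma len_proj_lt g : g != 1 -> len (proj g) < len g.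
Proof.
move=> g1; have [i gi] := right_descent f2 fgen g1.
by rewrite -gi ltnS; apply/prefix_len/proj_descent.
Qed.

Lemma voracious_exists g : exists2 v, voracious v & ev v = g.
Proof.
have [n] := ubnP (len g); elim: n g => // n IH g gn.
have [->|g1] := eqVneq g 1; first by exists [::]; [constructor | rewrite ev_nil].
have lt := len_proj_lt g1; have [|v vv vE] := IH (proj g); first by lia.
have [w wE sw] := len_wit fgen (gate g^-1)^-1.
have vwE : ev (v ++ w) = g by rewrite ev_cat vE wE /proj mulgK.
exists (v ++ w) => //; apply: voracious_cat; rewrite ?vwE ?wE //.
apply/eqP => w0; move: lt; rewrite /proj -[gate _]invgK -wE w0 ev_nil.
by rewrite invg1 mulg1 ltnn.
Qed.

Lemma projn1 k : projn k 1 = 1.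
Proof.
apply: (prefix_antisym fgen); first exact: projn_prefix.
by rewrite /prefix len1 invg1 mul1g.
Qed.

Lemma voracious_take v : voracious v ->
  forall k, ev (take (len (projn k (ev v))) v) = projn k (ev v).
Proof.
elim=> [|{}v w vv IH wn wE sw] k.
  by rewrite /= ev_nil projn1.
case: k => [|k].
  by rewrite take_oversize // (voracious_geodesic (voracious_cat vv wn wE sw)).
rewrite projnSr (proj_voracious wE) takel_cat ?IH // (voracious_geodesic vv).
exact/prefix_len/projn_prefix.
Qed.

Lemma len_take v a b : a <= b ->
  len ((ev (take a v))^-1 * ev (take b v)) <= minn b (size v) - a.
Proof.
move=> ab; rewrite -[take b v](cat_take_drop a) take_takel // ev_cat mulKg.
by apply: leq_trans (len_le f _) _; rewrite size_drop size_take_min.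
Qed.

Lemma len_projn k g : len (projn k g) <= len g - k.
Proof.
elim: k => [|k IH]; first by rewrite subn0.
have [E|n1] := eqVneq (projn k g) 1.
  by rewrite projnS E -[proj 1]/(projn 1 1) projn1 len1.
have := len_proj_lt n1; rewrite projnS; move: IH.
by move: (len (projn k g)) (len (proj (projn k g))) => *; lia.
Qed.

(** Choose k such that the k-th iterate for v is the last one met before time n, up
    to K; both words are geodesic and pass through their iterates, so the
    positions of the k-th iterates on v and v' differ by at most C + 1. *)
Lemma fellow_travel (t : W) C v v' : voracious v -> voracious v' -> len t <= 1 ->
  (forall k, len ((projn k (ev v))^-1 * t * projn k (ev v')) <= C) ->
  forall n, len ((ev (take n v))^-1 * t * ev (take n v')) <= K + C + (K + C).+1.
Proof.
move=> vv vv' t1 H n.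
have [k [kn kK]] : exists k, len (projn k (ev v)) <= n /\
    (k = 0 \/ n <= len (projn k (ev v)) + K).
  have ex : exists k, len (projn k (ev v)) <= n.
    by exists (len (ev v)); have := len_projn (len (ev v)) (ev v); lia.
  case: (ex_minnP ex) => -[|k] kn kmin; first by exists 0; split=> //; left.
  exists k.+1; split=> //; right.
  have kn' : n < len (projn k (ev v)).
    by rewrite ltnNge; apply/negP => /kmin; rewrite ltnn.
  have := len_proj (projn k (ev v)); rewrite -projnS.
  have := KP (projn k (ev v))^-1.
  move: kn'; move: (len (projn k (ev v))) (len (projn k.+1 (ev v))) (len (gate _)).
  by move=> *; lia.
have HA := voracious_take vv k; have HB := voracious_take vv' k.
have := H k; move: (H k) => Hk.
set A := projn k (ev v) in HA kn kK Hk *; set B := projn k (ev v') in HB Hk *.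
have ab : len A <= len B + C.+1.
  have := lenM fgen (t * B) (A^-1 * t * B)^-1; rewrite (lenV f2 fgen).
  have -> : t * B * (A^-1 * t * B)^-1 = A.
    by rewrite !invgM invgK !mulgA mulgK mulgV mul1g.
  have := lenM fgen t B; lia.
have ba : len B <= len A + C.+1.
  have := lenM fgen (t^-1 * A) (A^-1 * t * B).
  have -> : t^-1 * A * (A^-1 * t * B) = B by rewrite -!mulgA mulVKg mulKg.
  have := lenM fgen t^-1 A; rewrite (lenV f2 fgen t); move: Hk.
  by move: (len (t^-1 * A)) (len (A^-1 * t * B)) => *; lia.
move=> _; set P := ev (take n v); set Q := ev (take n v').
have PA : len (P^-1 * A) <= K.
  rewrite (len_sym f2 fgen) -{1}HA; apply: leq_trans (len_take v kn) _.
  case: kK => [k0|kK]; last by lia.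
  by rewrite /A k0 /= -(voracious_geodesic vv); lia.
have BQ : len (B^-1 * Q) <= (K + C).+1.
  have [bn|nb] := leqP (len B) n; last first.
    rewrite (len_sym f2 fgen) -{1}HB; apply: leq_trans (len_take v' (ltnW nb)) _.
    by lia.
  rewrite -{1}HB; apply: leq_trans (len_take v' bn) _.
  case: kK => [k0|kK]; last by lia.
  by rewrite /B k0 /= -(voracious_geodesic vv'); lia.
have -> : P^-1 * t * Q = P^-1 * A * (A^-1 * t * B) * (B^-1 * Q).
  by rewrite -!mulgA !mulVKg.
have := lenM fgen (P^-1 * A * (A^-1 * t * B)) (B^-1 * Q).
have := lenM fgen (P^-1 * A) (A^-1 * t * B).
move: Hk PA BQ; move: (len (A^-1 * t * B)) (len (P^-1 * A)) (len (B^-1 * Q)).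
move: (len (P^-1 * A * (A^-1 * t * B))) (len (P^-1 * A * (A^-1 * t * B) * (B^-1 * Q))).
by move=> *; lia.
Qed.

Definition reduced v := size v == len (ev v).

Lemma reduced_cat v w : reduced (v ++ w) -> reduced v /\ reduced w.
Proof.
rewrite /reduced size_cat ev_cat => /eqP E.
have := lenM fgen (ev v) (ev w); have := len_le f v; have := len_le f w.
by split; lia.
Qed.

(** The suffixes of v that may still grow into the last piece of a voracious word,
    up to their values. *)
Definition pending v (u : seq I) :=
  exists v1 w, [/\ v = v1 ++ w, voracious v1 & ev w = ev u].

Lemma pending_rcons v a (u : seq I) : size u <= K -> reduced (rcons v a) ->
  pending (rcons v a) u <->
  (exists u1 : K.-bseq I, pending v u1 /\ ev u1 * f a = ev u) \/
  (ev u = 1 /\ exists u1 : K.-bseq I,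
     pending v u1 /\ ev u1 * f a = (gate (f a * (ev v)^-1))^-1).
Proof.
move=> uK red; have invE : (ev (rcons v a))^-1 = f a * (ev v)^-1.
  by rewrite ev_rcons invgM (fV f2).
have split_last v1 w1 b : rcons v a = v1 ++ rcons w1 b -> v = v1 ++ w1 /\ a = b.
  by rewrite -rcons_cat => /rcons_inj[].
split=> [[v1 [w [vE vv wE]]]|].
  case/lastP: w => [|w b] in vE wE *.
    right; split; first by rewrite -wE ev_nil.
    have vv' : voracious (rcons v a) by rewrite vE cats0.
    clear vE vv wE; move: vv'; move vaE : (rcons v a) => va vv'.
    case: vv' vaE => [|v2 w2 vv2 w2n w2E sw2] vaE; first by case: (v) vaE.
    case/lastP: w2 => [//|w2 b] in w2n w2E sw2 vaE *.
    have [vE ab] := split_last _ _ _ vaE; subst b.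
    have w2K : size w2 <= K.
      have := sw2; rewrite w2E (lenV f2 fgen) size_rcons => h.
      by apply: ltnW; rewrite h; apply: KP.
    exists (Bseq w2K); split; first by exists v2, w2.
    by rewrite /= -ev_rcons w2E -vaE invE.
  have [vE' ab] := split_last _ _ _ vE; subst b; left.
  have wK : size w <= K.
    have [_] : reduced v1 /\ reduced (rcons w a) by apply: reduced_cat; rewrite -vE.
    rewrite /reduced wE size_rcons => /eqP h; apply: ltnW; rewrite h.
    exact: leq_trans (len_le f u) uK.
  exists (Bseq wK); split; first by exists v1, w.
  by rewrite /= -ev_rcons.
case=> [[u1 [[v1 [w [vE vv wE]]] uE]]|[u0 [u1 [[v1 [w [vE vv wE]]] uE]]]].
  exists v1, (rcons w a); split=> //; first by rewrite -rcons_cat vE.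
  by rewrite ev_rcons wE.
exists (rcons v a), [::]; split; rewrite ?cats0 ?ev_nil //.
have vaE : rcons v a = v1 ++ rcons w a by rewrite -rcons_cat vE.
rewrite vaE; apply: voracious_cat => //; first by case: (w).
  by rewrite -vaE invE ev_rcons wE.
apply/eqP; rewrite vaE in red; by have [] := reduced_cat red.
Qed.

(** A state consists of the cone class of the inverse of the value of the word and of
    its short pending suffixes. The colour of the gate is recorded instead of the
    colour of the element itself, since it depends only on the class. *)
Lemma voracious_regular : regular voracious.
Proof.
have [Q [col colP]] := finite_cone_types.
pose st v : option (Q * {set K.-bseq I}) :=
  if reduced v then Some (col (gate (ev v)^-1), [set u : K.-bseq I | `[< pending v u >]])
  else None.
have stP v v' : st v = st v' -> reduced v ->
    [/\ reduced v', cone_eq (ev v)^-1 (ev v')^-1 &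
     forall u : K.-bseq I, pending v u <-> pending v' u].
  rewrite /st => + rv; rewrite rv; case: ifP => // rv' [c X]; split=> // [|u].
    apply: cone_eq_trans (cone_eq_sym (gate_cone _)) _.
    exact: cone_eq_trans (colP _ _ c) (gate_cone _).
  have := congr1 (fun X : {set K.-bseq I} => u \in X) X; rewrite !inE => E.
  by split=> h; apply/asboolP; [rewrite -E | rewrite E]; apply/asboolP.
have redE v a : reduced v -> reduced (rcons v a) =
    (len (f a * (ev v)^-1) == (len (ev v)^-1).+1).
  rewrite /reduced => /eqP rv; rewrite size_rcons rv ev_rcons (lenV f2 fgen (ev v)).
  by rewrite -(lenV f2 fgen (_ * f a)) invgM (fV f2) eq_sym.
have step v v' a : st v = st v' -> reduced (rcons v a) ->
    st (rcons v a) = st (rcons v' a).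
  move=> E rva; have [rv _] : reduced v /\ reduced [:: a].
    by apply: reduced_cat; rewrite cats1.
  have [rv' ce X] := stP v v' E rv.
  have up : len (f a * (ev v)^-1) = (len (ev v)^-1).+1 by apply/eqP; rewrite -redE.
  have rva' : reduced (rcons v' a) by rewrite redE // (cone_eq_up ce up).
  have G : gate (f a * (ev v)^-1) = gate (f a * (ev v')^-1).
    exact/gate_class/cone_eq_fM.
  rewrite /st rva rva' !ev_rcons !invgM (fV f2) G; congr (Some (_, _)).
  apply/setP => u; rewrite !inE; apply/asbool_equiv_eq.
  have uK : size u <= K := size_bseq u.
  have HX (y : W) : (exists u1 : K.-bseq I, pending v u1 /\ ev u1 * f a = y) <->
      (exists u1 : K.-bseq I, pending v' u1 /\ ev u1 * f a = y).
    by split=> -[u1 [/X h1 h2]]; exists u1.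
  split=> /pending_rcons h; apply/pending_rcons => //.
    by case: (h uK rva) => [/HX|[h1]]; [left | rewrite G => /HX; right].
  by case: (h uK rva') => [/HX|[h1]]; [left | rewrite -G => /HX; right].
apply: (@regular_congruence _ _ _ st) => [v v' a E|v v' E vv].
  have [r|nr] := boolP (reduced (rcons v a)); first exact: step.
  have [r'|nr'] := boolP (reduced (rcons v' a)); first exact/esym/step.
  by rewrite /st (negbTE nr) (negbTE nr').
have rv : reduced v by apply/eqP/voracious_geodesic.
have [rv' _ X] := stP v v' E rv.
have /X[v1 [w [vE vv1 w1]]] : pending v (Bseq (leq0n K : size (Nil I) <= K)).
  by exists v, [::]; rewrite cats0.
have [_ rw] : reduced v1 /\ reduced w by apply: reduced_cat; rewrite -vE.
move: rw; rewrite /reduced w1 ev_nil len1 => /eqP/size0nil w0.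
by rewrite vE w0 cats0.
Qed.
End Fellow.

(** * Biautomaticity *)

Theorem gates_biautomatic : biautomatic W.
Proof.
have [K KP] := gate_bounded; have [K' K'P] := projn_left KP.
pose S : {fset W} := [fset x in codom f]%fset.
have mem_S x : x \in S = (x \in codom f) by rewrite inE.
have fS i : f i \in S by rewrite mem_S codom_f.
have Sf (s : S) : val s \in codom f by rewrite -mem_S; apply: valP.
pose r (s : S) : I := iinv (Sf s); pose F i : S := [` fS i]%fset.
have fr s : f (r s) = val s by rewrite /r f_iinv.
have rF i : r (F i) = i by apply: f_inj; rewrite fr.
have mapK u : map r (map F u) = u by rewrite -map_comp map_id_in // => i _ /=; apply: rF.
have valE (v : seq S) : word_val v = ev (map r v).
  by rewrite /word_val /gen_prod big_map; apply: eq_bigr => s _; rewrite fr.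
have genS : generating S.
  by move=> g; have [u uE] := fgen g; exists (map F u); rewrite valE mapK.
have wl g : word_length genS g <= len g.
  have [u uE <-] := len_wit fgen g.
  rewrite /word_length; case: ex_minnP => n _; apply.
  have sz : size (map F u) == size u by rewrite size_map.
  by apply/existsP; exists (Tuple sz); rewrite valE /= mapK uE.
have SI s : s \in S -> exists i, s = f i.
  by rewrite mem_S => /codomP.
exists S, genS; split.
  by move=> s /SI[i ->]; rewrite (fV f2).
exists (fun v => voracious (map r v)), (K + K + (K + K).+1), (K + K' + (K + K').+1).
split.
- by apply: regular_map; apply: voracious_regular KP.
- move=> g; have [u vu uE] := voracious_exists g.
  by exists (map F u); rewrite ?valE mapK.
- move=> s g g' v v' /SI[i ->] -> vv vE vv' v'E n _; apply: leq_trans (wl _) _.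
  rewrite !valE !map_take -[X in X * _]mulg1; apply: (fellow_travel KP) => //.
    by rewrite len1.
  by move=> k; rewrite mulg1 -!valE vE v'E; apply: projn_step.
- move=> s g g' v v' /SI[i ->] -> vv vE vv' v'E n _; apply: leq_trans (wl _) _.
  rewrite !valE !map_take (fV f2); apply: (fellow_travel KP) => //.
    by rewrite len_f1.
  by move=> k; rewrite -!valE vE v'E; apply: K'P.
Qed.
End Gates.

Local Close Scope group_scope.

Theorem mainTheorem1 (W : groupType) : coxeter_group W -> biautomatic W.
Proof.
move=> [I [m [f pres]]]; pose R : realType := Rdefinitions.R.
apply: (gates_biautomatic (f := f)).
- exact: pres_f2 pres.
- exact: pres_gen pres.
- exact: (gen_inj R pres).
- exact: (len_Mf_cases R pres).
- exact: (cone_eq_geodesic R pres).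
- exact: (cone_confluence R pres).
- exact: (finite_cone_types R pres).
- exact: (near_wall R pres).
Qed.
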